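(* Let $T>0$, let $g\in L_{2+\varepsilon}[0,1]$ for some $\varepsilon>0$ be a non-decreasing càdlàg function, and let $\{X(u,t),\ u\in(0,1),\ t\in[0,T]\}$ be a process with trajectories in $D((0,1),C[0,T])$ satisfying conditions (C1)–(C4) of the context with initial function $g$. Let $u_0\in(0,1)$, $\alpha>\frac12$, and suppose there exist $\delta>0$ (with $[u_0-\delta,u_0+\delta]\subset(0,1)$) and $C>0$ such that $$g(u_0+u)-g(u_0)\le Cu^{\alpha}\ \text{ for all } u\in[0,\delta],\qquad\text{or}\qquad g(u_0)-g(u_0-u)\le Cu^{\alpha}\ \text{ for all } u\in[0,\delta].$$ Then for all $\epsilon>0$ $$\mathbb{P}\left\{\lim_{t\to0}\frac{m(u_0,t)}{t^{\frac{1}{2\alpha+1}}\left(\ln\frac1t\right)^{-1-\epsilon}}=+\infty\right\}=1,$$ $$\mathbb{P}\left\{\lim_{t\to0}\frac{|X(u_0,t)-g(u_0)|}{t^{\frac{\alpha}{2\alpha+1}}\left(\ln\frac1t\right)^{\frac12+\epsilon}}=0\right\}=1.$$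
   Context: $C[0,T]$ is the space of real continuous functions on $[0,T]$ with the uniform norm; $D((0,1),C[0,T])$ is the set of right-continuous functions from $(0,1)$ to $C[0,T]$ having left limits. $\mathrm{Leb}$ is Lebesgue measure, $\mathbb{I}_A$ an indicator, $x\wedge y=\min(x,y)$, $\inf\emptyset=+\infty$. Conditions on $X$: (C1) for all $u\in(0,1)$, $X(u,\cdot)$ is a continuous square integrable martingale with respect to $\mathcal{F}_t=\sigma(X(u,s),\ s\le t,\ u\in(0,1))$, $t\in[0,T]$; (C2) $X(u,0)=g(u)$ for all $u\in(0,1)$; (C3) $X(u,t)\le X(v,t)$ for all $u<v$ and $t\in[0,T]$; (C4) for all $t\in[0,T]$ and $u,v\in(0,1)$, $\langle X(u,\cdot),X(v,\cdot)\rangle_t=\int_0^t\frac{\mathbb{I}_{\{\tau_{u,v}\le s\}}ds}{m(u,s)}$, where $m(u,t)=\mathrm{Leb}\{w\in(0,1):\ \exists s\le t\ \ X(u,s)=X(w,s)\}$ and $\tau_{u,v}=\inf\{t:\ X(u,t)=X(v,t)\}\wedge T$. *)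

(* Defs.v *)
From mathcomp Require Import all_boot all_order all_algebra.
From mathcomp Require Import all_classical all_reals all_analysis.
Set Implicit Arguments.
Unset Strict Implicit.
Unset Printing Implicit Defensive.
Import Order.TTheory GRing.Theory Num.Theory.
Import numFieldNormedType.Exports.
Local Open Scope classical_set_scope.
Local Open Scope ring_scope.

(* Processes are functions [time -> Omega -> R] (or [label -> time -> Omega -> R]
   for the flow); only their values at times in [0, T] and labels in ]0, 1[ are
   ever constrained, the other values are junk. *)

(* [g] is cadlag on ]0, 1[. *)
Definition cadlag01 (R : realType) (g : R -> R) : Prop :=
  forall u, 0 < u < 1 -> g @ u^'+ --> g u /\ cvg (g @ u^'-).

(* g \in L_p[0, 1], for a real exponent p. *)
Definition Lp01 (R : realType) (p : R) (g : R -> R) : Prop :=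
  measurable_fun (`[0, 1]%classic : set R) g /\
  (\int[lebesgue_measure]_(u in (`[0%R, 1%R]%classic : set R)) (`|g u| `^ p)%:E < +oo)%E.

(* x \in D(]0, 1[, C[0, T]): convergence is uniform in the time variable. *)
Definition D01C (R : realType) (T : R) (x : R -> R -> R) : Prop :=
  forall u, 0 < u < 1 ->
    [/\ {within `[0, T], continuous (x u)},
        {uniform `[0, T]%classic, x @ u^'+ --> x u} &
        exists2 f : R -> R, {within `[0, T], continuous f} &
          {uniform `[0, T]%classic, x @ u^'- --> f}].

Section martingales.
Context (R : realType) (d : measure_display) (Omega : measurableType d).
Variables (P : probability Omega R) (T : R).

Definition adapted (F : R -> set (set Omega)) (M : R -> Omega -> R) : Prop :=
  forall t, 0 <= t <= T ->
    preimage_set_system setT (M t) measurable `<=` F t.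

(* [Z] is a version of the conditional expectation E[Y | G]. *)
Definition is_cond_exp (G : set (set Omega)) (Y Z : Omega -> R) : Prop :=
  [/\ preimage_set_system setT Z measurable `<=` G,
      P.-integrable setT (EFin \o Z) &
      forall A, G A -> (\int[P]_(w in A) (Z w)%:E = \int[P]_(w in A) (Y w)%:E)%E].

Definition martingale (F : R -> set (set Omega)) (M : R -> Omega -> R) : Prop :=
  [/\ adapted F M,
      forall t, 0 <= t <= T -> P.-integrable setT (EFin \o M t) &
      forall s t, 0 <= s -> s <= t -> t <= T -> is_cond_exp (F s) (M t) (M s)].

Definition cont_sqint_martingale (F : R -> set (set Omega))
    (M : R -> Omega -> R) : Prop :=
  [/\ martingale F M,
      forall t, 0 <= t <= T ->
        P.-integrable setT (fun w => (M t w ^+ 2)%:E) &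
      forall w, {within `[0, T], continuous (fun t => M t w)}].

(* [Q] is a version of the bracket <M, N> of two continuous square integrable
   martingales: the (a.s. unique) adapted process, null at 0, with continuous
   paths of bounded variation, such that M N - Q is a martingale.  The path
   properties are only required almost surely because the filtration is not
   completed. *)
Definition is_bracket (F : R -> set (set Omega))
    (M N Q : R -> Omega -> R) : Prop :=
  [/\ adapted F Q,
      {ae P, forall w, [/\ Q 0 w = 0,
          {within `[0, T], continuous (fun t => Q t w)} &
          bounded_variation 0 T (fun t => Q t w)]} &
      martingale F (fun t w => M t w * N t w - Q t w)].

(* sigma (X u s, s <= t, u \in ]0, 1[) *)
Definition natural_filtration (X : R -> R -> Omega -> R) (t : R) :
    set (set Omega) :=
  <<s \bigcup_(p in [set p : R * R | 0 < p.1 < 1 /\ 0 <= p.2 <= t])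
        preimage_set_system setT (X p.1 p.2) measurable >>.

End martingales.

(* The next two notions are functionals of a single trajectory [x]. *)
Definition mass (R : realType) (x : R -> R -> R) (u t : R) : \bar R :=
  lebesgue_measure
    [set w : R | 0 < w < 1 /\ exists2 s, 0 <= s <= t & x u s = x w s].

(* Extended-real infimum, so that the infimum of the empty set is +oo. *)
Definition tau (R : realType) (T : R) (x : R -> R -> R) (u v : R) : \bar R :=
  mine (ereal_inf [set t%:E | t in [set t | 0 <= t <= T /\ x u t = x v t]])
       T%:E.

(* Right-hand side of the bracket formula.  The integrand is extended-real:
   1 / 0 = +oo, and 0 * +oo = 0 where the indicator vanishes. *)
Definition bracket_density_integral (R : realType) (T : R) (x : R -> R -> R)
    (u v t : R) : \bar R :=
  (\int[lebesgue_measure]_(s in (`[0%R, t]%classic : set R))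
    ((\1_[set r : R | (tau T x u v <= r%:E)%E] s : R)%:E / mass x u s))%E.

(* Main.v *)
(* Let D = X(v) - X(u), a nonnegative martingale started at g(v) - g(u). Stopping
   it on reaching sqrt K shows that its bracket exceeds K with probability at
   most 3 (g(v) - g(u)) / sqrt K. If m(u0,t) < r, the particle u0 has not met
   u0 + r (or u0 - r) by time t, so the bracket of the difference is at least of
   order t / r, and the Hoelder condition yields
   P(m(u0,t) < r) <= c r^(alpha+1/2) t^(-1/2). Borel-Cantelli at the times 2^-n
   and the monotonicity of the mass in time give the first limit. Since
   alpha + 1/2 > 1, the same tail bound shows that 1/m(u0,t) has mean of order
   t^(-1/(2 alpha+1)), hence the bracket of X(u0) at time t has mean of order
   t^(2 alpha/(2 alpha+1)); Doob's inequality and Borel-Cantelli at the times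
   2^-n give the second limit. *)

Require Import Defs.
From mathcomp Require Import all_boot all_order all_algebra.
From mathcomp Require Import all_classical all_reals all_analysis.
From mathcomp Require Import measurable_realfun ring lra.
Set Implicit Arguments.
Unset Strict Implicit.
Unset Printing Implicit Defensive.
Import Order.TTheory GRing.Theory Num.Theory.
Import numFieldNormedType.Exports.
Local Open Scope classical_set_scope.
Local Open Scope ring_scope.

(** * Stopped martingales in discrete time *)

(** Weak regularity shapes the argument. Neither the set of merged labels nor the dependence of its
    mass on the outcome is shown to be measurable, so each tail bound is carried by a measurable
    event [E] that almost surely contains the event of interest. (C3) and (C4) provide one null set
    per choice of labels and time; order and coalescence reach all times at once through rational
    times and labels, by continuity in time and right-continuity in the label. Stopping takes place
    on finite grids, and path continuity removes the overshoot as the mesh shrinks. The exponents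
    come from one balance: the tail [r^(alpha+1/2) t^(-1/2)] is of order one at
    [r = t^(1/(2 alpha+1))]. Dividing this [r] by [n] at [t = 2^-n] leaves [n^-(alpha+1/2)], which
    is summable because [alpha > 1/2]; the division by [n] is the power [-1] of the logarithm in the
    first limit. For the second limit, [1/m] is singular at time 0, so its integral is estimated on
    [[t/2, t]], where monotonicity bounds it by its value at [t/2], and the pieces are then
    telescoped. *)

Section Rintegral_complements.
Context (R : realType) (d : measure_display) (Omega : measurableType d).
Variable mu : {measure set Omega -> \bar R}.

Lemma integrable_scale (A : set Omega) (f : Omega -> R) (k : R) :
  measurable A -> mu.-integrable A (EFin \o f) ->
  mu.-integrable A (EFin \o (fun w => k * f w)).
Proof.
move=> mA fi; exact: eq_integrable (integrableZl mA k fi).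
Qed.

Lemma ae_le_Rintegral (A : set Omega) (f g : Omega -> R) :
  measurable A -> mu.-integrable A (EFin \o f) ->
  mu.-integrable A (EFin \o g) -> {ae mu, forall w, A w -> f w <= g w} ->
  \int[mu]_(w in A) f w <= \int[mu]_(w in A) g w.
Proof.
move=> mA fi gi fg; rewrite -subr_ge0 -RintegralB//.
(* The absolute value trades nonnegativity almost everywhere for nonnegativity everywhere. *)
have -> : \int[mu]_(w in A) (g w - f w) = \int[mu]_(w in A) `|g w - f w|.
  congr fine; apply: ae_eq_integral => //.
  - exact: (measurable_int mu (integrableB mA gi fi)).
  - apply: (measurable_int mu (integrable_norm (integrableB mA gi fi))).
  - by apply: filterS fg => w fgw Aw /=; rewrite ger0_norm// subr_ge0 fgw.
by apply: Rintegral_ge0.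
Qed.

Lemma Rintegral_bigsetU (n : nat) (F : nat -> set Omega) (f : Omega -> R) :
  (forall i, (i < n)%N -> measurable (F i)) -> trivIset setT F ->
  mu.-integrable setT (EFin \o f) ->
  \int[mu]_(w in \big[setU/set0]_(i < n) F i) f w =
  \sum_(i < n) \int[mu]_(w in F i) f w.
Proof.
move=> + tF fi; elim: n => [_|n IHn mF].
  by rewrite !big_ord0 Rintegral_set0.
have mFn : measurable (\big[setU/set0]_(i < n) F i).
  by apply: bigsetU_measurable => i _; apply: mF; rewrite ltnS ltnW.
rewrite !big_ord_recr/= Rintegral_setU//.
- by rewrite IHn// => i ilt; apply: mF; rewrite ltnS ltnW.
- exact: mF.
- by apply: integrableS fi => //; apply: measurableU => //; exact: mF.
- apply/disj_setPS; rewrite -(big_mkord xpredT F) => w [].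
  rewrite big_mkord -bigcup_mkord => -[i /= ilt Fi] Fn.
  by move: ilt; rewrite (tF i n I I) ?ltnn//; exists w.
Qed.

Lemma Rintegral_setC (A : set Omega) (f : Omega -> R) :
  measurable A -> mu.-integrable setT (EFin \o f) ->
  \int[mu]_w f w = \int[mu]_(w in A) f w + \int[mu]_(w in ~` A) f w.
Proof.
move=> mA fi; rewrite -Rintegral_setU ?setUv//; first exact: measurableC.
by apply/disj_setPS; rewrite setICr.
Qed.

Lemma ge0_le_Rintegral_set (A B : set Omega) (f : Omega -> R) :
  measurable A -> measurable B -> A `<=` B ->
  mu.-integrable B (EFin \o f) -> {ae mu, forall w, 0 <= f w} ->
  \int[mu]_(w in A) f w <= \int[mu]_(w in B) f w.
Proof.
move=> mA mB AB fi f0.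
have mBA : measurable (B `\` A) by exact: measurableD.
have -> : B = A `|` (B `\` A) by rewrite setDUK.
have fA := integrableS mB mA AB fi.
have fBA := integrableS mB mBA (@subDsetl _ _ _) fi.
rewrite Rintegral_setU//; last 2 first.
- by rewrite setDUK.
- by apply/disj_setPS; rewrite setDIK.
rewrite lerDl; apply: (@le_trans _ _ (\int[mu]_(w in B `\` A) 0)).
  by rewrite Rintegral_ge0.
apply: ae_le_Rintegral => //; first exact: integrable0.
by apply: filterS f0.
Qed.

End Rintegral_complements.

Section maximal_inequality.
Context (R : realType) (d : measure_display) (Omega : measurableType d).
Variable P : probability Omega R.

Lemma Rintegral_lower_bound (A : set Omega) (f : Omega -> R) (c : R) :
  measurable A -> P.-integrable A (EFin \o f) ->
  (forall w, A w -> c <= f w) -> c * fine (P A) <= \int[P]_(w in A) f w.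
Proof.
move=> mA fi cf; rewrite -Rintegral_cst//; apply: le_Rintegral => //.
exact: finite_measure_integrable_cst.
Qed.

(** Doob's argument: [seqDU] cuts the exceedance event according to the first index at which the
    level is reached. The piece of index [i] lies in [F i], so replacing [Y i], which is at least
    [a] there, by [Y n] does not lower the integral. *)
Lemma maximal_inequality (F : nat -> set (set Omega)) (Y : nat -> Omega -> R)
    (n : nat) (a : R) :
  (forall i, (i <= n)%N -> F i `<=` measurable) ->
  (forall i, (i <= n)%N -> P.-integrable setT (EFin \o Y i)) ->
  (forall i A, (i <= n)%N -> F i A ->
     \int[P]_(w in A) Y i w <= \int[P]_(w in A) Y n w) ->
  {ae P, forall w, 0 <= Y n w} ->
  (forall i, (i <= n)%N -> F i (seqDU (fun j => [set w | a <= Y j w]) i)) ->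
  a * fine (P (\big[setU/set0]_(i < n.+1) [set w | a <= Y i w])) <=
  \int[P]_w Y n w.
Proof.
move=> mF Yi Ysub Y0 adapt; set H := fun j => [set w | a <= Y j w].
have mH i : (i < n.+1)%N -> measurable (seqDU H i).
  by move=> ilt; apply: (mF i) => //; exact: adapt.
have mU : measurable (\big[setU/set0]_(i < n.+1) seqDU H i).
  by apply: bigsetU_measurable => i _; exact: mH.
have tH := trivIset_seqDU H.
rewrite (bigsetU_seqDU H) -Rintegral_cst// Rintegral_bigsetU//; last first.
  exact: finite_measure_integrable_cst.
apply: (@le_trans _ _
    (\int[P]_(w in \big[setU/set0]_(i < n.+1) seqDU H i) Y n w)).
  rewrite (Rintegral_bigsetU mH tH (Yi n (leqnn n))).
  apply: ler_sum => i _; have iltn : (i <= n)%N by rewrite -ltnS.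
  apply: le_trans (Ysub i _ iltn (adapt i iltn)).
  rewrite Rintegral_cst; last exact: mH.
  apply: Rintegral_lower_bound; first exact: mH.
    by apply: integrableS (Yi i iltn) => //; exact: mH.
  by move=> w [].
by apply: ge0_le_Rintegral_set => //; exact: Yi.
Qed.

(* Stop [D] on reaching level [a]: the bracket of the stopped process has mean
   at most that of its square, which is [2 * a * x] up to the event [B] that
   the level is overshot by a jump larger than [a]. *)
Lemma bracket_tail_discrete (F : nat -> set (set Omega))
    (D Q : nat -> Omega -> R) (n : nat) (a K x : R) (B : set Omega) :
  let N i w := D i w ^+ 2 - Q i w in
  let H := fun j => [set w | a <= D j w] in
  0 < a ->
  (forall i, (i <= n)%N -> F i `<=` measurable) ->
  (forall i, (i <= n)%N -> P.-integrable setT (EFin \o D i)) ->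
  (forall i, (i <= n)%N -> P.-integrable setT (EFin \o N i)) ->
  (forall i A, (i <= n)%N -> F i A ->
     \int[P]_(w in A) D i w = \int[P]_(w in A) D n w) ->
  (forall i A, (i <= n)%N -> F i A ->
     \int[P]_(w in A) N i w = \int[P]_(w in A) N n w) ->
  P.-integrable setT (fun w => (D n w ^+ 2)%:E) ->
  F 0%N setT ->
  (forall i, (i <= n)%N -> {ae P, forall w, 0 <= D i w}) ->
  (forall i, (i <= n)%N -> {ae P, forall w, 0 <= Q i w}) ->
  {ae P, forall w, Q 0%N w = 0} ->
  (forall i, (i <= n)%N -> F i (seqDU H i)) ->
  (forall i, (i <= n)%N -> F i (seqDU H i `&` [set w | 2 * a < D i w])) ->
  \int[P]_w D n w = x ->
  measurable B ->
  (forall i, (i <= n)%N -> seqDU H i `&` [set w | 2 * a < D i w] `<=` B) ->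
  measurable [set w | K <= Q n w] ->
  0 < K ->
  fine (P [set w | K <= Q n w]) <=
    x / a + (2 * a * x + \int[P]_(w in B) `|N n w|) / K.
Proof.
move=> N H a0 mF Di Ni Dm Nm D2i F0 D0 Q0 Q00 adapt adapt2 Ex mB HB mK K0.
have mH i : (i < n.+1)%N -> measurable (seqDU H i).
  by move=> ilt; apply: (mF i) => //; exact: adapt.
set U := \big[setU/set0]_(i < n.+1) seqDU H i.
have mU : measurable U by apply: bigsetU_measurable => i _; exact: mH.
have tH := trivIset_seqDU H.
have hit : fine (P U) <= x / a.
  rewrite ler_pdivlMr// mulrC /U -(bigsetU_seqDU H) -Ex.
  apply: (maximal_inequality (F := F)) => //; last exact: D0.
  by move=> i A ilen FA; rewrite Dm.
have Qi : P.-integrable setT (EFin \o Q n).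
  apply: (eq_integrable _ (fun w => (D n w ^+ 2)%:E - (N n w)%:E)%E) => //.
    by move=> w _; rewrite /N -EFinB subKr.
  by apply: integrableB => //; exact: Ni.
(* Off [U] the level has not been reached, so Markov's inequality leaves the integral of
   [Q n = D n ^+ 2 - N n] over the complement of [U] to be bounded. *)
have nohit : fine (P (~` U `&` [set w | K <= Q n w])) <=
    (2 * a * x + \int[P]_(w in B) `|N n w|) / K.
  have mZ : measurable (~` U) by exact: measurableC.
  have mZK : measurable (~` U `&` [set w | K <= Q n w]) by exact: measurableI.
  have sub A f : measurable A -> P.-integrable setT f -> P.-integrable A f.
    by move=> mA; exact: integrableS.
  rewrite ler_pdivlMr// mulrC.
  apply: (@le_trans _ _ (\int[P]_(w in ~` U) Q n w)).
    apply: (@le_trans _ _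
        (\int[P]_(w in ~` U `&` [set w | K <= Q n w]) Q n w)).
      by apply: Rintegral_lower_bound => //; [exact: sub|move=> w []].
    by apply: ge0_le_Rintegral_set => //; [exact: sub|exact: Q0].
  have NU : \int[P]_(w in U) N n w <=
      \int[P]_(w in B) `|N n w| + 2 * a * \int[P]_(w in U) D n w.
    set J := fun i => seqDU H i `&` [set w | 2 * a < D i w].
    have mJ i : (i < n.+1)%N -> measurable (J i).
      by move=> ilt; apply: (mF i) => //; exact: adapt2.
    have tJ : trivIset setT J.
      move=> i j _ _ [w [[Hi _] [Hj _]]].
      by apply: (tH i j I I); exists w.
    apply: (@le_trans _ _ (\sum_(i < n.+1) (\int[P]_(w in J i) `|N n w| +
        2 * a * \int[P]_(w in seqDU H i) D n w))).
      rewrite (Rintegral_bigsetU mH tH (Ni n (leqnn n))).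
      apply: ler_sum => i _; have iltn : (i <= n)%N by rewrite -ltnS.
      rewrite -(Nm i _ iltn (adapt i iltn)) -(Dm i _ iltn (adapt i iltn)).
      have mHi := mH i (ltn_ord i); have mJi := mJ i (ltn_ord i).
      have mHJ : measurable (seqDU H i `\` J i) by exact: measurableD.
      have HJ : seqDU H i = J i `|` (seqDU H i `\` J i).
        by rewrite setDUK//; exact: subIsetl.
      rewrite {1}HJ Rintegral_setU//; last 2 first.
      - by rewrite -HJ; apply: sub => //; exact: Ni.
      - by apply/disj_setPS; rewrite setDIK.
      (* On the overshoot piece [J i] the integrand returns to the final time. The error is then an
         integral of the single function [N n] over [B], which suits dominated convergence when the
         grid is refined. *)
      rewrite (Nm i _ iltn (adapt2 i iltn)); apply: lerD.
        apply: le_Rintegral => //.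
        + by apply: sub => //; exact: Ni.
        + by apply: sub => //; apply: integrable_norm; exact: Ni.
        + by move=> w _; exact: ler_norm.
      rewrite -RintegralZl//; last by apply: sub => //; exact: Di.
      have Di2 : P.-integrable setT (EFin \o (fun w => 2 * a * D i w)).
        by apply: integrable_scale => //; exact: Di.
      apply: (@le_trans _ _ (\int[P]_(w in seqDU H i `\` J i) (2 * a * D i w))).
        apply: ae_le_Rintegral => //; [|exact: sub|].
          by apply: sub => //; exact: Ni.
        apply: filterS2 (Q0 i iltn) (D0 i iltn) => w Qw Dw [Hw] /=.
        move=> /not_andP[//|/negP]; rewrite -leNgt => Da.
        rewrite /N lerBlDr expr2; apply: le_trans (ler_wpM2r Dw Da) _.
        by rewrite lerDl.
      apply: ge0_le_Rintegral_set => //; first exact: sub.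
      apply: filterS (D0 i iltn) => w Dw.
      by rewrite !mulr_ge0// ltW.
    rewrite big_split/= -mulr_sumr -(Rintegral_bigsetU mH tH (Di n (leqnn n))).
    rewrite lerD2r -(Rintegral_bigsetU mJ tJ); last first.
      by apply: integrable_norm; exact: Ni.
    apply: ge0_le_Rintegral_set => //.
    - by apply: bigsetU_measurable => i _; exact: mJ.
    - rewrite -(big_mkord xpredT J) big_mkord -bigcup_mkord => w [i /= ilt].
      exact: HB.
    - by apply: sub => //; apply: integrable_norm; exact: Ni.
    - by apply: aeW => w.
  (* The total integral of [N n] equals that of [N 0], which is [D 0 ^+ 2] almost surely, hence
     nonnegative. *)
  have NZ : - (\int[P]_(w in ~` U) N n w) <= \int[P]_(w in U) N n w.
    rewrite -subr_ge0 opprK -Rintegral_setC//; last exact: Ni.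
    rewrite -(Nm 0%N setT)//.
    apply: (@le_trans _ _ (\int[P]_w 0)); first by rewrite Rintegral_ge0.
    apply: ae_le_Rintegral => //; [exact: integrable0|exact: Ni|].
    by apply: filterS Q00 => w Qw _; rewrite /N Qw subr0 sqr_ge0.
  have DZ : \int[P]_(w in ~` U) (D n w ^+ 2) <= a * \int[P]_(w in ~` U) D n w.
    rewrite -RintegralZl//; last by apply: sub => //; exact: Di.
    apply: ae_le_Rintegral => //; [exact: sub| |].
      by apply: integrable_scale => //; apply: sub => //; exact: Di.
    apply: filterS (D0 n (leqnn n)) => w Dw; rewrite /U -(bigsetU_seqDU H) => Uw.
    rewrite expr2 ler_wpM2r// leNgt; apply/negP => aD; apply: Uw.
    by rewrite big_ord_recr; right; exact: ltW.
  have QZ : \int[P]_(w in ~` U) Q n w =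
      \int[P]_(w in ~` U) (D n w ^+ 2) - \int[P]_(w in ~` U) N n w.
    rewrite -RintegralB//; [|exact: sub|by apply: sub => //; exact: Ni].
    by apply: eq_Rintegral => w _; rewrite /N subKr.
  have DZ0 : 0 <= \int[P]_(w in ~` U) D n w.
    apply: (@le_trans _ _ (\int[P]_(w in ~` U) 0)); first by rewrite Rintegral_ge0.
    apply: ae_le_Rintegral => //; first exact: integrable0.
      by apply: sub => //; exact: Di.
    by apply: filterS (D0 n (leqnn n)).
  have := Rintegral_setC mU (Di n (leqnn n)); rewrite Ex QZ => ->.
  have : 0 <= a * \int[P]_(w in ~` U) D n w by rewrite mulr_ge0// ltW.
  lra.
apply: le_trans (lerD hit nohit).
rewrite -fineD ?fin_num_measure//; last by apply: measurableI => //; exact: measurableC.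
apply: fine_le; rewrite ?fin_num_measure//.
  rewrite fin_numD !fin_num_measure//.
  by apply: measurableI => //; exact: measurableC.
rewrite -measureU//; last 2 first.
- by apply: measurableI => //; exact: measurableC.
- by rewrite setIA setICr set0I.
apply: le_measure; rewrite ?inE//.
  by apply: measurableU => //; apply: measurableI => //; exact: measurableC.
by move=> w Kw; have [Uw|Uw] := pselect (U w); [left|right].
Qed.

End maximal_inequality.

(** * Continuous martingales *)

Section paths.
Context (R : realType).

(** Heine's theorem by compactness: [Pk k x] says that [k] is a modulus at [x], and half of a local
    radius for tolerance [e / 2] serves all nearby points at once. *)
Lemma within_continuous_unif (T : R) (f : R -> R) (e : R) :
  {within `[0, T], continuous f} -> 0 < e ->
  exists2 k : R, 0 < k & forall x y, 0 <= x <= T -> 0 <= y <= T ->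
    `|x - y| < k -> `|f x - f y| < e.
Proof.
move=> /subspace_continuousP cf e0.
pose Pk (k x : R) := 0 <= x <= T ->
  forall y, 0 <= y <= T -> `|x - y| < k -> `|f x - f y| < e.
have [] := @compact_near_coveringP R (`[0, T]%classic) => + _.
move=> /(_ (@segment_compact _ _ _))/(_ R (0^'+) Pk _) H.
have : \forall k \near 0^'+, `[0, T]%classic `<=` Pk k.
  apply: H => x /= xT; have /cvgrPdist_lt := cf x xT.
  move=> /(_ (e / 2))[]; first by rewrite divr_gt0.
  move=> k /= k0 Hk; exists (ball x (k / 2), [set l : R | 0 < l < k / 2]) => /=.
    split; first by apply: nbhsx_ballx; rewrite divr_gt0.
    near=> l => /=; apply/andP; split=> //.
    near: l; apply: nbhs_right_lt; rewrite divr_gt0//.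
  move=> [x' l] /= [xx' /andP[l0 lk]] x'T y yT x'y.
  have fx' : `|f x - f x'| < e / 2.
    apply: Hk; first by apply: lt_le_trans xx' _;
      rewrite ler_pdivrMr// ler_peMr// ?ler1n// ltW.
    by rewrite /= in_itv.
  have fy : `|f x - f y| < e / 2.
    apply: Hk; last by rewrite /= in_itv.
    rewrite /= (splitr k) (le_lt_trans (ler_distD x' _ _))// ltrD//.
    exact: lt_trans lk.
  rewrite (splitr e) (le_lt_trans (ler_distD (f x) _ _))// ltrD//.
  by rewrite distrC.
move=> H0; have [k [k0 Hk]] := filter_ex (filterI (nbhs_right_gt (0 : R)) H0).
exists k => // x y xT yT; exact: (Hk x).
Unshelve. all: end_near. Qed.

End paths.

Section fair.
Context (R : realType) (d : measure_display) (Omega : measurableType d).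
Variables (P : probability Omega R) (T : R) (F : R -> set (set Omega)).
Hypothesis mF : forall t, 0 <= t <= T -> F t `<=` measurable.

(* A martingale, apart from adaptedness. *)
Definition fair (Z : R -> Omega -> R) : Prop :=
  (forall t, 0 <= t <= T -> P.-integrable setT (EFin \o Z t)) /\
  (forall s t A, 0 <= s -> s <= t -> t <= T -> F s A ->
     \int[P]_(w in A) Z s w = \int[P]_(w in A) Z t w).

Lemma martingale_fair Z : martingale P T F Z -> fair Z.
Proof.
move=> [_ Zi Zc]; split => // s t A s0 st tT FA.
by have [_ _ e] := Zc s t s0 st tT; rewrite /Rintegral e.
Qed.

Let sT s t : 0 <= s -> s <= t -> t <= T -> (0 <= s <= T) * (0 <= t <= T).
Proof.
by move=> s0 st tT; rewrite s0 tT (le_trans s0 st) (le_trans st tT).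
Qed.

Lemma fairD Z W : fair Z -> fair W -> fair (fun t w => Z t w + W t w).
Proof.
move=> [Zi Zf] [Wi Wf]; split=> [t tT|s t A s0 st tT FA].
  apply: eq_integrable (integrableD measurableT (Zi t tT) (Wi t tT)) => //.
have [sT' tT'] := sT s0 st tT; have mA := mF sT' FA.
have i U r : fair U -> 0 <= r <= T -> P.-integrable A (EFin \o U r).
  by move=> [Ui _] rT; apply: integrableS (Ui r rT).
rewrite !RintegralD//; try exact: i.
by rewrite (Zf s t)// (Wf s t).
Qed.

Lemma fairZ k Z : fair Z -> fair (fun t w => k * Z t w).
Proof.
move=> [Zi Zf]; split=> [t tT|s t A s0 st tT FA].
  by apply: integrable_scale => //; exact: Zi.
have [sT' tT'] := sT s0 st tT; have mA := mF sT' FA.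
rewrite !RintegralZl ?(Zf s t)//.
  by apply: integrableS (Zi t tT').
by apply: integrableS (Zi s sT').
Qed.

Lemma fair_cst k : fair (fun _ _ => k).
Proof.
split=> // t _; exact: finite_measure_integrable_cst.
Qed.

Lemma eq_fair Z W : (forall t w, Z t w = W t w) -> fair Z -> fair W.
Proof. by move=> ZW; have -> // : W = Z; apply/funext => t; apply/funext. Qed.

End fair.

(** * Adaptedness as measurability, and first hitting events *)

Section adapted.
Context (R : realType) (d : measure_display) (Omega : measurableType d).
Variables (T : R) (F : R -> set (set Omega)).
Hypothesis sF : forall t, 0 <= t <= T -> sigma_algebra setT (F t).
Hypothesis nF : forall s t, 0 <= s -> s <= t -> t <= T -> F s `<=` F t.

(** A sigma-algebra generates itself. Reading [F t] as a measurable structure gives access to the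
    closure properties of measurable sets and functions. *)
Lemma sigma_algebra_measurableE (t : R) : 0 <= t <= T ->
  F t = @measurable _ (g_sigma_algebraType (F t)).
Proof. by move=> /sF/sigma_algebra_id/esym. Qed.

Lemma adaptedP (D : R -> Omega -> R) :
  adapted T F D <-> forall t, 0 <= t <= T ->
    measurable_fun (setT : set (g_sigma_algebraType (F t))) (D t).
Proof.
split=> aD t tT.
  move=> _ Y mY; rewrite -sigma_algebra_measurableE//.
  by apply: (aD t tT); exists Y.
move=> _ [Y mY <-]; rewrite sigma_algebra_measurableE//.
exact: (aD t tT).
Qed.

Lemma adaptedB (D E : R -> Omega -> R) : adapted T F D -> adapted T F E ->
  adapted T F (fun t w => D t w - E t w).
Proof.
move=> /adaptedP aD /adaptedP aE; apply/adaptedP => t tT.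
by apply: measurable_funB; [exact: aD|exact: aE].
Qed.

(** The function [f] covers three uses: the identity for hitting a level, the square for a two-sided
    level, and the opposite for strict levels by complementation. *)
Lemma adapted_level (D : R -> Omega -> R) (f : R -> R) t (a : R) :
  adapted T F D -> measurable_fun setT f -> 0 <= t <= T ->
  F t [set w | a <= f (D t w)].
Proof.
move=> /adaptedP aD mf tT; rewrite sigma_algebra_measurableE//.
rewrite (_ : [set w | _] = (f \o D t) @^-1` `[a, +oo[).
  rewrite -[X in measurable X]setTI.
  have : measurable_fun (setT : set (g_sigma_algebraType (F t))) (f \o D t).
    by apply: measurableT_comp => //; exact: aD.
  by apply.
by apply/seteqP; split => w /=; rewrite in_itv/= andbT.
Qed.

(** Whether [s n] is the first grid time at which [H] occurs is known at time [s n], since the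
    earlier events lie in smaller sigma-algebras. *)
Lemma adapted_seqDU (H : R -> set Omega) (s : nat -> R) (n : nat) :
  {homo s : i j / (i <= j)%N >-> i <= j} -> 0 <= s 0%N -> s n <= T ->
  (forall t, 0 <= t <= T -> F t (H t)) -> F (s n) (seqDU (fun i => H (s i)) n).
Proof.
move=> hs s0 sn FH.
have snT : 0 <= s n <= T by rewrite sn andbT (le_trans s0)// hs.
rewrite sigma_algebra_measurableE//; apply: measurableD.
  by rewrite -sigma_algebra_measurableE//; exact: FH.
apply: bigsetU_measurable => i _; rewrite -sigma_algebra_measurableE//.
have sin : s i <= s n by apply: hs; rewrite ltnW.
have si0 : 0 <= s i by rewrite (le_trans s0)// hs.
by apply: (nF si0 sin sn); apply: FH; rewrite si0 (le_trans sin).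
Qed.

End adapted.

Section continuous_martingales.
Context (R : realType) (d : measure_display) (Omega : measurableType d).
Variables (P : probability Omega R) (T : R) (F : R -> set (set Omega)).
Hypothesis sF : forall t, 0 <= t <= T -> sigma_algebra setT (F t).
Hypothesis nF : forall s t, 0 <= s -> s <= t -> t <= T -> F s `<=` F t.
Hypothesis mF : forall t, 0 <= t <= T -> F t `<=` measurable.

(** The level [a = sqrt K] makes both terms of the discrete bound of the same form:
    [x / a + 2 * a * x / K = 3 * x / a]. The overshoot error vanishes in the limit of fine grids,
    because each continuous path started at [x <= a] leaves [B k] for large [k] and [N t] is
    integrable. *)
Lemma bracket_tail (D Q : R -> Omega -> R) (x K t : R) :
  0 < t -> t <= T -> 0 < K -> 0 <= x ->
  adapted T F D -> fair P T F D ->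
  fair P T F (fun s w => D s w ^+ 2 - Q s w) ->
  P.-integrable setT (fun w => (D t w ^+ 2)%:E) ->
  (forall w, {within `[0, T], continuous (D^~ w)}) ->
  (forall s, 0 <= s <= T -> {ae P, forall w, 0 <= D s w}) ->
  (forall s, 0 <= s <= T -> {ae P, forall w, 0 <= Q s w}) ->
  {ae P, forall w, D 0 w = x} -> {ae P, forall w, Q 0 w = 0} ->
  fine (P [set w | K <= Q t w]) <= 3 * (x / Num.sqrt K).
Proof.
move=> t0 tT K0 x0 aD Dm Nm D2i cD D0 Q0 Dx Q00.
set a := Num.sqrt K; have a0 : 0 < a by rewrite sqrtr_gt0.
have aK : a ^+ 2 = K by rewrite sqr_sqrtr// ltW.
have T0 : 0 <= T by rewrite (le_trans (ltW t0)).
have tT' : 0 <= t <= T by rewrite (ltW t0).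
have F0T : F 0 setT.
  have [|F00 FC _] := sF (t := 0); first by rewrite lexx.
  by rewrite -(setD0 setT); exact: FC.
pose N s w := D s w ^+ 2 - Q s w.
have Qi : P.-integrable setT (EFin \o Q t).
  apply: (eq_integrable _ (fun w => (D t w ^+ 2)%:E - (N t w)%:E)%E) => //.
    by move=> w _; rewrite /N -EFinB subKr.
  by apply: integrableB => //; exact: (Nm.1 t).
have mlev (f : Omega -> R) c : P.-integrable setT (EFin \o f) ->
    measurable [set w | c <= f w].
  move=> /measurable_int/measurable_EFinP mf.
  have := mf measurableT `[c, +oo[%classic (measurable_itv _).
  rewrite setTI; congr measurable.
  by apply/seteqP; split => w /=; rewrite in_itv/= andbT.
(* If [x > a] the claimed bound exceeds one. Otherwise the start is at most [a], below the overshoot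
   threshold [2 * a]. *)
have [ax|xa] := ltP a x.
  apply: (@le_trans _ _ 1).
    rewrite -lee_fin fineK ?fin_num_measure//; last exact: mlev.
    by apply: probability_le1; exact: mlev.
  have : 1 <= x / a by rewrite ler_pdivlMr// mul1r ltW.
  by lra.
have Di s : 0 <= s <= T -> P.-integrable setT (EFin \o D s) := Dm.1 s.
pose s k i : R := t * (i%:R / k.+1%:R).
have sk0 k : s k 0%N = 0 by rewrite /s mul0r mulr0.
have skn k : s k k.+1 = t by rewrite /s divff ?mulr1// pnatr_eq0.
have shom k : {homo s k : i j / (i <= j)%N >-> i <= j}.
  by move=> i j ij; rewrite /s ler_wpM2l ?ler_wpM2r ?invr_ge0// ?ler_nat// ltW.
have skT k i : (i <= k.+1)%N -> 0 <= s k i <= T.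
  move=> ik; rewrite -{1}(sk0 k) shom//= (le_trans _ tT)// -(skn k).
  exact: shom.
(* Just before the first hitting index the value is below [a], so a value above [2 * a] at that
   index forces an increment above [a]. The first set handles a hit at index 0, which has no
   predecessor; [D 0 = x] holds only almost surely. *)
pose B k : set Omega := [set w | 2 * a < D 0 w] `|`
  \big[setU/set0]_(i < k.+1) [set w | a < D (s k i.+1) w - D (s k i) w].
have mgt (f : Omega -> R) c : P.-integrable setT (EFin \o f) ->
    measurable [set w | c < f w].
  move=> /measurable_int/measurable_EFinP mf.
  have := mf measurableT `]c, +oo[%classic (measurable_itv _).
  rewrite setTI; congr measurable.
  by apply/seteqP; split => w /=; rewrite in_itv/= andbT.
have mB k : measurable (B k).
  apply: measurableU; first by apply: mgt; apply: Di; rewrite lexx.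
  apply: bigsetU_measurable => i _.
  apply: (@mgt (fun w => D (s k i.+1) w - D (s k i) w)).
  apply: (integrableB measurableT (Di _ _) (Di _ _)); first exact: skT.
  by apply: skT; rewrite ltnW// ltnS.
have Ni u : 0 <= u <= T -> P.-integrable setT (EFin \o N u) := Nm.1 u.
have tail k : fine (P [set w | K <= Q t w]) <=
    x / a + (2 * a * x + \int[P]_(w in B k) `|N t w|) / K.
  have := @bracket_tail_discrete _ _ _ P (fun i => F (s k i))
    (fun i => D (s k i)) (fun i => Q (s k i)) k.+1 a K x (B k).
  rewrite /= skn; apply => //.
  - by move=> i ik; apply: mF; exact: skT.
  - by move=> i ik; apply: Di; exact: skT.
  - by move=> i ik; apply: Ni; exact: skT.
  - move=> i A ik FA; have /andP[? ?] := skT _ _ ik.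
    by rewrite (Dm.2 (s k i) t A)// -(skn k); exact: shom.
  - move=> i A ik FA; have /andP[? ?] := skT _ _ ik.
    by rewrite (Nm.2 (s k i) t A)// -(skn k); exact: shom.
  - by rewrite sk0.
  - by move=> i ik; apply: D0; exact: skT.
  - by move=> i ik; apply: Q0; exact: skT.
  - by rewrite sk0.
  - move=> i ik; have /andP[_ siT] := skT _ _ ik.
    apply: (@adapted_seqDU _ _ _ T F sF nF (fun r => [set w | a <= D r w])) => //.
      by rewrite sk0.
    by move=> r rT; apply: (@adapted_level _ _ _ T F sF D id).
  - move=> i ik; have /andP[_ siT] := skT _ _ ik.
    have siT' := skT _ _ ik.
    rewrite (sigma_algebra_measurableE sF) //; apply: measurableI.
      rewrite -(sigma_algebra_measurableE sF) //.
      apply: (@adapted_seqDU _ _ _ T F sF nF (fun r => [set w | a <= D r w])) => //.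
        by rewrite sk0.
      by move=> r rT; apply: (@adapted_level _ _ _ T F sF D id).
    rewrite (_ : [set w | _] = ~` [set w | - (2 * a) <= - D (s k i) w]).
      apply: measurableC; rewrite -(sigma_algebra_measurableE sF)//.
      by apply: (@adapted_level _ _ _ T F sF D -%R) => //.
    apply/seteqP; split => w /=; rewrite lerN2 ltNge; first by move/negP.
    by move=> /negP.
  - have -> : \int[P]_w D t w = \int[P]_w D 0 w.
      by rewrite (Dm.2 0 t)// ltW.
    have -> : \int[P]_w D 0 w = \int[P]_w (fun=> x) w.
      congr fine; apply: ae_eq_integral => //.
      + by apply: (measurable_int P); apply: Di; rewrite lexx.
      + by apply: filterS Dx => w -> _.
    by rewrite Rintegral_cst// [X in fine X](probability_setT P) mulr1.
  - move=> [|i] ik w [[]].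
      by move=> _ _ /=; left; rewrite /= -(sk0 k).
    move=> _ nhit /= aD2; right; rewrite -(bigcup_mkord k.+1 (fun i =>
      [set w | a < D (s k i.+1) w - D (s k i) w])); exists i => //=.
    have : D (s k i) w < a.
      rewrite ltNge; apply/negP => aDi; apply: nhit.
      by rewrite big_ord_recr/=; right.
    by lra.
  - exact: mlev.
have lim0 : (\int[P]_(w in B k) `|N t w|) @[k --> \oo] --> 0.
  pose f k w := ((fun w => `|N t w|) \_ (B k)) w.
  have mN : measurable_fun setT (EFin \o (fun w => `|N t w|)).
    by apply: (measurable_int P); apply: integrable_norm; exact: Ni.
  have mf k : measurable_fun setT (EFin \o f k).
    apply/measurable_EFinP/(measurable_restrictT _ (mB k)).1.
    by apply: measurable_funTS; apply/measurable_EFinP.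
  have fcv : {ae P, forall w, setT w ->
      (EFin \o f k) w @[k --> \oo] --> (0 : \bar R)%E}.
    apply: filterS Dx => w Dw _; apply: cvg_near_cst.
    have [l l0 Hl] := within_continuous_unif (cD w) a0.
    near=> k; rewrite /f/= /patch; case: ifPn => //; rewrite inE => -[/=|].
      by rewrite Dw ltNge (le_trans xa)// ler_peMl ?ler1n// ltW.
    rewrite -(bigcup_mkord k.+1 (fun i =>
      [set w | a < D (s k i.+1) w - D (s k i) w])) => -[i /= ik].
    have /ltr_normlW : `|D (s k i.+1) w - D (s k i) w| < a.
      apply: Hl; [exact: skT|by apply: skT; rewrite ltnW// ltnS|].
      rewrite /s -mulrBr -mulrBl -natrB// subSnn ger0_norm; last first.
        by rewrite mulr_ge0 ?invr_ge0// ltW.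
      rewrite mul1r ltr_pdivrMr// mulrC -ltr_pdivrMr//.
      apply: lt_trans (_ : k%:R < _); last by rewrite ltr_nat.
      by near: k; exact: nbhs_infty_gtr.
    by move=> h1 h2; have := lt_trans h1 h2; rewrite ltxx.
  have fle : {ae P, forall w, forall k, setT w ->
      (`|(EFin \o f k) w| <= (EFin \o (Num.norm \o N t)) w)%E}.
    apply: aeW => w k _ /=; rewrite lee_fin /f /patch.
    by case: ifPn => _; rewrite ?normr_id// normr0.
  have [_ _] := dominated_convergence measurableT mf
    (@measurable_cst _ _ _ _ setT (0 : \bar R)%E) fcv
    (integrable_norm (Ni t tT')) fle.
  rewrite integral0 => /fine_cvg; apply: cvg_trans.
  apply: near_eq_cvg; near=> k; rewrite Rintegral_mkcond//.
have : (x / a + (2 * a * x + \int[P]_(w in B k) `|N t w|) / K) @[k --> \oo]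
    --> x / a + (2 * a * x + 0) / K.
  apply: cvgD; first exact: cvg_cst.
  by apply: cvgMl; apply: cvgD => //; exact: cvg_cst.
move=> lim; have -> : 3 * (x / a) = x / a + (2 * a * x + 0) / K.
  rewrite -aK; field; exact: lt0r_neq0.
by apply: (cvgr_to_ge lim); near=> k; exact: tail.
Unshelve. all: end_near. Qed.

(** Doob's inequality for [M ^+ 2] on dyadic grids. The grids are nested, so the exceedance events
    increase to a union [E] with the same bound. A strict exceedance at any time leaves a margin
    [|M s| - l], and continuity carries it to a grid point. *)
Lemma running_max_tail (M Q : R -> Omega -> R) (l t : R) :
  0 < t -> t <= T -> 0 < l ->
  adapted T F M ->
  fair P T F (fun s w => M s w ^+ 2 - Q s w) ->
  (forall s, 0 <= s <= T -> P.-integrable setT (fun w => (M s w ^+ 2)%:E)) ->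
  (forall w, {within `[0, T], continuous (M^~ w)}) ->
  (forall s, 0 <= s <= t -> {ae P, forall w, Q s w <= Q t w}) ->
  {ae P, forall w, M 0 w = 0} -> {ae P, forall w, Q 0 w = 0} ->
  exists E : set Omega, [/\ measurable E,
    (forall w s, 0 <= s <= t -> l < `|M s w| -> E w) &
    fine (P E) <= (\int[P]_w Q t w) / l ^+ 2].
Proof.
move=> t0 tT l0 aM Nm M2i cM Qle M0 Q00.
have T0 : 0 <= T by rewrite (le_trans (ltW t0)).
have tT' : 0 <= t <= T by rewrite (ltW t0).
have F0T : F 0 setT.
  have [|F00 FC _] := sF (t := 0); first by rewrite lexx.
  by rewrite -(setD0 setT); exact: FC.
pose N s w := M s w ^+ 2 - Q s w.
have Ni s : 0 <= s <= T -> P.-integrable setT (EFin \o N s) := Nm.1 s.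
have Qi s : 0 <= s <= T -> P.-integrable setT (EFin \o Q s).
  move=> sT; apply: (eq_integrable _ (fun w => (M s w ^+ 2)%:E - (N s w)%:E)%E) => //.
    by move=> w _; rewrite /N -EFinB subKr.
  by apply: integrableB => //; [exact: M2i|exact: Ni].
have M2E s A : 0 <= s <= T -> measurable A ->
    \int[P]_(w in A) (M s w ^+ 2) =
    \int[P]_(w in A) N s w + \int[P]_(w in A) Q s w.
  move=> sT mA; rewrite -RintegralD//.
  - by apply: eq_Rintegral => w _; rewrite /N subrK.
  - by apply: integrableS (Ni s sT).
  - by apply: integrableS (Qi s sT).
have EM2 : \int[P]_w (M t w ^+ 2) = \int[P]_w Q t w.
  rewrite M2E// -(Nm.2 0 t setT) ?(ltW t0)//.
  rewrite [X in X + _](_ : _ = 0) ?add0r//.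
  transitivity (\int[P]_w (fun=> 0) w : R); last first.
    by rewrite Rintegral_cst// mul0r.
  congr fine; apply: ae_eq_integral => //.
    by apply: (measurable_int P); apply: Ni; rewrite lexx.
  by apply: filterS2 M0 Q00 => w Mw Qw _; rewrite Mw Qw expr0n subrr.
pose s k i : R := t * (i%:R / (2 ^ k)%:R).
have sk0 k : s k 0%N = 0 by rewrite /s mul0r mulr0.
have skn k : s k (2 ^ k)%N = t.
  by rewrite /s divff ?mulr1// pnatr_eq0 expn_eq0.
have shom k : {homo s k : i j / (i <= j)%N >-> i <= j}.
  by move=> i j ij; rewrite /s ler_wpM2l ?ler_wpM2r ?invr_ge0// ?ler_nat// ltW.
have skt k i : (i <= 2 ^ k)%N -> 0 <= s k i <= t.
  by move=> ik; rewrite -{1}(sk0 k) shom//= -[leRHS](skn k) shom.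
have skT k i : (i <= 2 ^ k)%N -> 0 <= s k i <= T.
  by move=> /skt/andP[-> /le_trans->].
pose H r := [set w | l ^+ 2 <= M r w ^+ 2].
pose E k := \big[setU/set0]_(i < (2 ^ k).+1) H (s k i).
have FH r : 0 <= r <= T -> F r (H r).
  move=> rT; apply: (@adapted_level _ _ _ T F sF M (fun x => x ^+ 2)) => //.
have mE k : measurable (E k).
  apply: bigsetU_measurable => i _.
  by have iT := skT k i (ltn_ord i); apply: (mF iT); exact: FH.
have l20 : 0 < l ^+ 2 by rewrite exprn_gt0.
have PE k : (P (E k) <= ((\int[P]_w Q t w) / l ^+ 2)%:E)%E.
  rewrite -[leLHS]fineK ?fin_num_measure// lee_fin ler_pdivlMr// mulrC -EM2.
  rewrite -[in leRHS](skn k).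
  apply: (@maximal_inequality _ _ _ P (fun i => F (s k i))
    (fun i w => M (s k i) w ^+ 2) (2 ^ k) (l ^+ 2)).
  - by move=> i ik; apply: mF; exact: skT.
  - by move=> i ik; apply: M2i; exact: skT.
  (* The submartingale property of [M ^+ 2 = N + Q]: the part [N] keeps its integrals over [A], and
     [Q] increases. *)
  - move=> i A ik FA; have iT := skT k i ik; have mA := mF iT FA.
    have /andP[i0 _] := iT; have it := shom k _ _ ik; rewrite skn in it.
    rewrite skn !M2E// (Nm.2 (s k i) t)// lerD2l.
    apply: ae_le_Rintegral => //.
    + by apply: integrableS (Qi _ iT).
    + by apply: integrableS (Qi _ tT').
    + by apply: filterS (Qle _ (skt k i ik)).
  - by apply: aeW => w; exact: sqr_ge0.
  - move=> i ik; have /andP[_ iT] := skT k i ik.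
    by apply: (@adapted_seqDU _ _ _ T F sF nF H) => //; rewrite sk0.
have ndE : {homo E : n m / (n <= m)%N >-> (n <= m)%O}.
  apply/nondecreasing_seqP => k; apply/subsetPset => w.
  rewrite /E -(bigcup_mkord _ (fun i => H (s k i))).
  rewrite -(bigcup_mkord _ (fun i => H (s k.+1 i))) => -[i /= ik Hi].
  exists (2 * i)%N => /=; first by rewrite expnS ltnS leq_mul2l/= -ltnS.
  rewrite (_ : s k.+1 _ = s k i)// /s expnS !natrM -mulf_div divff ?mul1r//.
exists (\bigcup_k E k); split.
- exact: bigcupT_measurable.
- move=> w r rt lM.
  have [//|k k0 Hk] := @within_continuous_unif _ T (M^~ w) (`|M r w| - l) (cM w).
    by rewrite subr_gt0.
  have rT : 0 <= r <= T by have /andP[-> /le_trans->] := rt.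
  near \oo => n.
  have p0 : 0 < (2 ^ n)%:R :> R by rewrite ltr0n expn_gt0.
  have r0 : 0 <= r / t * (2 ^ n)%:R.
    by rewrite mulr_ge0// divr_ge0// ?(ltW t0)//; have /andP[] := rt.
  (* The last grid point at or before [r]. Its distance to [r] is less than [t / 2 ^ n], which is at
     most the modulus [k] once [n >= t / k]. *)
  pose i := Num.truncn (r / t * (2 ^ n)%:R).
  have /andP[i1 i2] := truncn_itv r0.
  have rE : r = t * (r / t * (2 ^ n)%:R / (2 ^ n)%:R).
    by field; rewrite !lt0r_neq0.
  have ni : (i <= 2 ^ n)%N.
    rewrite -(ler_nat R) (le_trans i1)// ler_piMl// ler_pdivrMr// mul1r.
    by have /andP[] := rt.
  exists n => //; rewrite /E -(bigcup_mkord _ (fun i => H (s n i))).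
  exists i => //=; rewrite /H /= -[leRHS]real_normK ?num_real//.
  rewrite ler_pXn2r ?nnegrE// ?(ltW l0)//.
  have : `|M r w - M (s n i) w| < `|M r w| - l.
    apply: Hk => //; first exact: skT.
    rewrite {1}rE /s -mulrBr -mulrBl normrM normrM gtr0_norm//.
    rewrite [X in _ * (_ * X)]gtr0_norm ?invr_gt0//.
    rewrite mulrA ltr_pdivrMr// ger0_norm ?subr_ge0//.
    apply: (@lt_le_trans _ _ (t * 1)).
      by rewrite ltr_pM2l// ltrBlDl -natr1 in i2 *.
    rewrite mulr1 -ler_pdivrMl//.
    apply: (@le_trans _ _ n%:R); last by rewrite ler_nat ltnW// ltn_expl.
    by near: n; exact: nbhs_infty_ger.
  have := ler_dist_dist (M r w) (M (s n i) w).
  have := ler_norm (`|M r w| - `|M (s n i) w|).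
  by lra.
- have := nondecreasing_cvg_mu mE (bigcupT_measurable E mE) ndE (mu := P).
  move=> cvE; rewrite -lee_fin fineK ?fin_num_measure//; last exact: bigcupT_measurable.
  rewrite -(cvg_lim _ cvE)//; apply: lime_le; first by apply/cvg_ex; eexists; exact: cvE.
  by near=> k; exact: PE.
Unshelve. all: end_near. Qed.

End continuous_martingales.

(** * Masses and coalescence times of a trajectory *)

Section lower_integral.
Context (d : measure_display) (S : measurableType d) (R : realType).
Variable mu : {measure set S -> \bar R}.
Import HBNNSimple.
Local Open Scope ereal_scope.

(* Valid without measurability because the integral of a nonnegative function
   is defined as a supremum over the simple functions below it. *)
Lemma ge0_le_lower_integral (A B : set S) (f h : S -> \bar R) : A `<=` B ->
  (forall x, B x -> 0 <= f x) -> (forall x, B x -> 0 <= h x) ->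
  (forall x, A x -> f x <= h x) ->
  \int[mu]_(x in A) f x <= \int[mu]_(x in B) h x.
Proof.
move=> AB f0 h0 fh.
rewrite !ge0_integralE//; last by move=> x /AB; exact: f0.
apply: le_ereal_sup => _ [k kf <-]; exists k => // x.
apply: le_trans (kf x) _; rewrite /patch.
case: ifPn => [/set_mem Ax|_]; case: ifPn => [/set_mem Bx|nB] //.
- exact: fh.
- by move: nB; rewrite mem_set//; exact: AB.
- exact: h0.
Qed.

End lower_integral.

Section trajectories.
Context (R : realType).
Variables (T : R) (x : R -> R -> R).
Local Notation mu := (@lebesgue_measure R).

Lemma mass_ge0 u t : (0 <= mass x u t)%E.
Proof. exact: measure_ge0. Qed.

(** The comparison is that of the outer measure, as the set of merged labels is not known to be
    measurable. *)
Lemma le_mass u s t : s <= t -> (mass x u s <= mass x u t)%E.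
Proof.
move=> st; apply: le_mu_ext => w [w01 [r /andP[r0 rs] xr]]; split=> //.
by exists r => //; rewrite r0 (le_trans rs).
Qed.

Lemma tau_refl_le u s : 0 <= T -> 0 <= s -> (tau T x u u <= s%:E)%E.
Proof.
move=> T0 s0; rewrite /tau ge_min; apply/orP; left.
apply: ereal_inf_le; exists 0%:E; last by rewrite lee_fin.
by exists 0 => //; split => //; rewrite lexx.
Qed.

Let dens u v (s : R) : \bar R :=
  ((\1_[set r : R | (tau T x u v <= r%:E)%E] s : R)%:E / mass x u s)%E.

Let dens_ge0 u v s : (0 <= dens u v s)%E.
Proof. by rewrite /dens mule_ge0// ?lee_fin ?inve_ge0 ?mass_ge0. Qed.

Let dens_refl u s : 0 <= T -> 0 <= s -> dens u u s = ((mass x u s)^-1)%E.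
Proof.
move=> T0 s0; rewrite /dens indicE mem_set ?mul1e//=; exact: tau_refl_le.
Qed.

Lemma bracket_density_integral_ge0 u v t :
  (0 <= bracket_density_integral T x u v t)%E.
Proof. by apply: integral_ge0 => s _; exact: dens_ge0. Qed.

Lemma le_bracket_density_integral u v s t : s <= t ->
  (bracket_density_integral T x u v s <= bracket_density_integral T x u v t)%E.
Proof.
move=> st; apply: ge0_le_lower_integral => //.
- by apply: subset_itvl; rewrite bnd_simp.
- by move=> r _; exact: dens_ge0.
- by move=> r _; exact: dens_ge0.
Qed.

(** On the diagonal the indicator is identically one. This is what makes [Quu - Quv] nonnegative in
    the bracket of a difference. *)
Lemma bracket_density_integral_le_refl u v t : 0 <= T ->
  (bracket_density_integral T x u v t <= bracket_density_integral T x u u t)%E.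
Proof.
move=> T0; apply: ge0_le_lower_integral => //.
- by move=> r _; exact: dens_ge0.
- by move=> r _; exact: dens_ge0.
- move=> r /=; rewrite in_itv/= => /andP[r0 _].
  rewrite -/(dens u v r) -/(dens u u r) dens_refl// /dens.
  rewrite gee_pMl ?inve_ge0 ?mass_ge0 ?lee_fin//.
Qed.

(** The mass increases in time, so its bound at time [t] holds throughout [[0, t]] and the density
    is at least [1 / r] there. *)
Lemma bracket_density_integral_ge u t r : 0 <= T -> 0 <= t -> 0 < r ->
  (mass x u t <= r%:E)%E ->
  ((t / r)%:E <= bracket_density_integral T x u u t)%E.
Proof.
move=> T0 t0 r0 mr.
have -> : (t / r)%:E = (\int[mu]_(s in `[0%R, t]%classic) (r^-1)%:E)%E.
  rewrite integral_cst//= lebesgue_measure_itv/= lte_fin.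
  case: ltP => [_|]; first by rewrite EFinM sube0 muleC.
  by move=> t0'; rewrite (le_anti (introT andP (conj t0' t0))) mul0r mule0.
apply: ge0_le_lower_integral => //.
- by move=> s _; rewrite lee_fin invr_ge0 ltW.
- by move=> s _; exact: dens_ge0.
move=> s /=; rewrite in_itv/= => /andP[s0 st].
rewrite -/(dens u u s) dens_refl//.
have -> : (r^-1)%:E = (r%:E^-1)%E by rewrite inver gt_eqF.
rewrite lee_pV2 ?inE ?mass_ge0 ?lee_fin ?(ltW r0)//.
by apply: le_trans mr; exact: le_mass.
Qed.

(** The absence of a meeting up to [t], together with the cap at [T], gives only [tau >= t]. The
    room between [s] and [t] makes the indicator vanish on all of [[0, s]]. *)
Lemma bracket_density_integral_eq0 u v s t : s < t -> t <= T ->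
  (forall r, 0 <= r <= t -> x u r <> x v r) ->
  bracket_density_integral T x u v s = 0%E.
Proof.
move=> st tT ne; apply: integral0_eq => r /=; rewrite in_itv/= => /andP[r0 rs].
rewrite indicE memNset ?mul0e//= /tau ge_min => /orP[|]; last first.
  by rewrite lee_fin => /(le_trans tT)/(lt_le_trans st)/lt_le_trans/(_ rs);
    rewrite ltxx.
move=> /le_lt_trans/(_ (_ : r%:E < t%:E)%E).
rewrite lte_fin (le_lt_trans rs)// => /(_ isT)/ereal_inf_lt.
move=> [_ [q [/andP[q0 qT] xq] <-]]; rewrite lte_fin => qt.
by apply: (ne q) => //; rewrite q0 ltW.
Qed.

Lemma bracket_density_integral_incr u s t r : 0 <= T -> 0 <= s -> s <= t ->
  0 < r -> (r%:E <= mass x u s)%E ->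
  (bracket_density_integral T x u u t <=
   bracket_density_integral T x u u s + ((t - s) / r)%:E)%E.
Proof.
move=> T0 s0 st r0 rm.
(* Splitting the integral at [s] as an equality requires measurability. The density [1 / mass] is
   nonincreasing, so its superlevel sets are intervals. *)
have mdens : measurable_fun (`[0, t]%classic : set R) (dens u u).
  apply: (measurability _ (ErealGenCInfty.measurableE R)) => _ [_ [y ->] <-].
  apply: is_interval_measurable => a b /= [+ +] [+ +] c /andP[ac cb].
  rewrite !in_itv/= !andbT => /andP[a0 at_] ya /andP[b0 bt] yb.
  have c0 : 0 <= c := le_trans a0 ac.
  rewrite c0 (le_trans cb bt); split=> //.
  apply: le_trans yb _; rewrite !dens_refl//.
  by rewrite lee_pV2 ?inE ?mass_ge0//; exact: le_mass.
rewrite /bracket_density_integral.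
have -> : `[0, t]%classic = `[0, s]%classic `|` `]s, t]%classic :> set R.
  by rewrite -itv_bndbnd_setU ?bnd_simp.
rewrite ge0_integral_setU//=; last 3 first.
- by rewrite -itv_bndbnd_setU ?bnd_simp//.
- by move=> q _; exact: dens_ge0.
- apply/disj_setPS => q []/=; rewrite !in_itv/= => /andP[_ qs] /andP[sq _].
  by move: (le_lt_trans qs sq); rewrite ltxx.
apply: leeD2l.
have -> : ((t - s) / r)%:E = (\int[mu]_(q in `]s, t]%classic) (r^-1)%:E)%E.
  rewrite integral_cst//= lebesgue_measure_itv/= lte_fin.
  case: ltP => [_|ts]; first by rewrite EFinM muleC EFinB.
  by rewrite (le_anti (introT andP (conj ts st))) subrr mul0r mule0.
apply: ge0_le_lower_integral => //.
- by move=> q _; exact: dens_ge0.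
- by move=> q _; rewrite lee_fin invr_ge0 ltW.
move=> q /=; rewrite in_itv/= => /andP[sq qt].
have q0 : 0 <= q by rewrite (le_trans s0)// ltW.
rewrite -/(dens u u q) dens_refl//.
have -> : (r^-1)%:E = (r%:E^-1)%E by rewrite inver gt_eqF.
rewrite lee_pV2 ?inE ?mass_ge0 ?lee_fin ?(ltW r0)//.
by apply: le_trans rm _; apply: le_mass; exact: ltW.
Qed.

Lemma D01C_pointwise u s : D01C T x -> 0 < u < 1 -> 0 <= s <= T ->
  x w s @[w --> u^'+] --> x u s.
Proof.
move=> xD u01 sT; have [_ + _] := xD u u01.
have sub : [set s] `<=` `[0, T]%classic by move=> r /= ->; rewrite in_itv.
by move=> /(uniform_subset_cvg _ sub); rewrite uniform_set1.
Qed.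

(** When [u] and [v] meet, every rational label between them is squeezed to the same position.
    Right-continuity in the label extends this to all of []u, v[], an interval of length [v - u]
    that both masses then contain. *)
Lemma coalescence_mass u v s t : D01C T x -> 0 < u -> u < v -> v < 1 ->
  0 <= s -> s <= t -> s <= T -> x u s = x v s ->
  (forall q : rat, u < ratr q < v -> x u s <= x (ratr q) s <= x v s) ->
  ((v - u)%:E <= mass x u t)%E /\ ((v - u)%:E <= mass x v t)%E.
Proof.
move=> xD u0 uv v1 s0 st sT xuv xq.
have xw w : u < w < v -> x w s = x u s.
  move=> /andP[uw wv]; apply/eqP/negPn/negP => xneq.
  have e0 : 0 < `|x w s - x u s| by rewrite normr_gt0 subr_eq0.
  have w01 : 0 < w < 1 by rewrite (lt_trans u0)// (lt_trans wv).
  have sT' : 0 <= s <= T by rewrite s0.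
  have /cvgrPdist_lt/(_ _ e0) := D01C_pointwise xD w01 sT'.
  move=> [r /= r0 Hr].
  (* A rational label just to the right of [w] lies at the common position, yet closer to [x w s]
     than that position is: a contradiction. *)
  have [|q] := @rat_in_itvoo R w (Num.min v (w + r)).
    by rewrite lt_min wv ltrDl.
  rewrite in_itv/= lt_min => /and3P[wq qv qr].
  have := Hr (ratr q); rewrite /= distrC ger0_norm ?subr_ge0 ?(ltW wq)//.
  rewrite ltrBlDl => /(_ qr wq).
  have := xq q; rewrite qv (lt_trans uw wq) -xuv => /(_ isT) /le_anti <-.
  by rewrite ltxx.
have -> : ((v - u)%:E = mu `]u, v[%classic)%E.
  by rewrite lebesgue_measure_itv/= lte_fin uv EFinB.
split; apply: le_mu_ext => w /=; rewrite in_itv/= => /andP[uw wv];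
  (split; first by rewrite (lt_trans u0)// (lt_trans wv)).
- by exists s; rewrite ?s0 ?st// (xw w)// uw.
- by exists s; rewrite ?s0 ?st// (xw w) ?uw.
Qed.

End trajectories.

Lemma le_continuous_rat (R : realType) (T : R) (f h : R -> R) : 0 < T ->
  {within `[0, T], continuous f} -> {within `[0, T], continuous h} ->
  (forall q : rat, 0 <= (ratr q : R) <= T -> f (ratr q) <= h (ratr q)) ->
  forall s, 0 <= s <= T -> f s <= h s.
Proof.
move=> T0 cf ch fh s sT; rewrite leNgt; apply/negP => hf.
have e0 : 0 < (f s - h s) / 2 by rewrite divr_gt0// subr_gt0.
have [k k0 Hk] := within_continuous_unif cf e0.
have [l l0 Hl] := within_continuous_unif ch e0.
have /andP[s0 sT'] := sT.
have [|q] := @rat_in_itvoo R (Num.max 0 (s - Num.min k l)) (Num.min T (s + Num.min k l)).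
  have m0 : 0 < Num.min k l by rewrite lt_min k0.
  by rewrite gt_max !lt_min T0/=; apply/and3P; split; lra.
rewrite in_itv/= gt_max lt_min => /andP[/andP[q0 sq] /andP[qT qs]].
have qT' : 0 <= (ratr q : R) <= T by rewrite (ltW q0) ltW.
have : `|s - ratr q| < Num.min k l by rewrite ltr_distlC; apply/andP; split; lra.
rewrite lt_min => /andP[sk sl].
have := Hk s (ratr q) sT qT' sk; have := Hl s (ratr q) sT qT' sl.
rewrite !ltr_norml => /andP[? ?] /andP[? ?].
have := fh q qT'; lra.
Qed.

Lemma ae_forall_rat (d : measure_display) (S : measurableType d) (R : realType)
    (mu : {measure set S -> \bar R}) (A : rat -> S -> Prop) :
  (forall q, {ae mu, forall w, A q w}) -> {ae mu, forall w, forall q, A q w}.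
Proof.
move=> H.
have : {ae mu, forall w, forall n : nat,
    if unpickle n is Some q then A q w else True}.
  apply: ae_foralln => n; case: (unpickle n) => [q|]; first exact: H.
  exact: aeW.
by apply: filterS => w Hw q; have := Hw (pickle q); rewrite pickleK.
Qed.

(** * Coalescence estimates for the flow *)

Section natural_filtration.
Context (R : realType) (d : measure_display) (Omega : measurableType d).
Variables (T : R) (X : R -> R -> Omega -> R).

Lemma natural_filtration_sigma_algebra t :
  sigma_algebra setT (natural_filtration X t).
Proof. exact: smallest_sigma_algebra. Qed.

Lemma le_natural_filtration s t : s <= t ->
  natural_filtration X s `<=` natural_filtration X t.
Proof.
move=> st; apply: smallest_sub; first exact: smallest_sigma_algebra.
apply: subset_trans (@sub_sigma_algebra _ _ _) => A [p [p01 /andP[p0 ps]] HA].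
by exists p => //; split=> //; rewrite p0 (le_trans ps).
Qed.

Lemma natural_filtration_measurable t :
  (forall u s, 0 < u < 1 -> 0 <= s <= T -> measurable_fun setT (X u s)) ->
  0 <= t <= T -> natural_filtration X t `<=` measurable.
Proof.
move=> mX /andP[_ tT]; apply: smallest_sub.
  exact: sigma_algebra_measurable.
move=> A [p [p01 /andP[p0 pt]] [Y mY <-]].
apply: (mX p.1 p.2 p01 _ measurableT Y mY).
by rewrite p0 (le_trans pt).
Qed.

End natural_filtration.

Section flow.
Context (R : realType) (d : measure_display) (Omega : measurableType d).
Variables (P : probability Omega R) (T : R).
Hypothesis T_gt0 : 0 < T.
Variables (g : R -> R) (X : R -> R -> Omega -> R).
Hypothesis g_ndecr : {in `]0, 1[ &, {homo g : u v / u <= v}}.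
Hypothesis X_meas : forall u t, 0 < u < 1 -> 0 <= t <= T ->
  measurable_fun setT (X u t).
Hypothesis X_traj : forall w, D01C T (fun u t => X u t w).
Hypothesis C1 : forall u, 0 < u < 1 ->
  cont_sqint_martingale P T (natural_filtration X) (X u).
Hypothesis C2 : forall u, 0 < u < 1 -> {ae P, forall w, X u 0 w = g u}.
Hypothesis C3 : forall u v t, 0 < u -> u < v -> v < 1 -> 0 <= t <= T ->
  {ae P, forall w, X u t w <= X v t w}.
Hypothesis C4 : forall u v, 0 < u < 1 -> 0 < v < 1 ->
  exists2 Q : R -> Omega -> R,
    is_bracket P T (natural_filtration X) (X u) (X v) Q &
    forall t, 0 <= t <= T ->
      {ae P, forall w, (Q t w)%:E =
        bracket_density_integral T (fun u' s => X u' s w) u v t}.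

Let F := natural_filtration X.
Local Notation traj w := (fun u s => X u s w).

Let sF t : 0 <= t <= T -> sigma_algebra setT (F t).
Proof. by move=> _; exact: natural_filtration_sigma_algebra. Qed.

Let nF s t : 0 <= s -> s <= t -> t <= T -> F s `<=` F t.
Proof. by move=> _ st _; exact: le_natural_filtration. Qed.

Let mF t : 0 <= t <= T -> F t `<=` measurable.
Proof. exact: natural_filtration_measurable. Qed.

(** (C3) has a null set for each time; the rational times share one, and path continuity gives the
    other times. *)
Lemma flow_ordered u v : 0 < u -> u < v -> v < 1 ->
  {ae P, forall w, forall s, 0 <= s <= T -> X u s w <= X v s w}.
Proof.
move=> u0 uv v1.
have : {ae P, forall w, forall q : rat,
    0 <= (ratr q : R) <= T -> X u (ratr q) w <= X v (ratr q) w}.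
  apply: ae_forall_rat => q.
  have [qT|nq] := boolP (0 <= (ratr q : R) <= T); last exact: aeW.
  by apply: filterS (C3 u0 uv v1 qT).
apply: filterS => w Hw s sT.
have u01 : 0 < u < 1 by rewrite u0 (lt_trans uv).
have v01 : 0 < v < 1 by rewrite v1 (lt_trans u0).
have [cu _ _] := X_traj w u01; have [cv _ _] := X_traj w v01.
exact: (le_continuous_rat T_gt0 cu cv).
Qed.

Lemma flow_coalescence u v : 0 < u -> u < v -> v < 1 ->
  {ae P, forall w, forall s t, 0 <= s -> s <= t -> t <= T ->
     X u s w = X v s w ->
     ((v - u)%:E <= mass (traj w) u t)%E /\ ((v - u)%:E <= mass (traj w) v t)%E}.
Proof.
move=> u0 uv v1.
have : {ae P, forall w, forall q : rat, u < ratr q < v ->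
    forall s, 0 <= s <= T -> X u s w <= X (ratr q) s w <= X v s w}.
  apply: ae_forall_rat => q.
  have [/andP[uq qv]|nq] := boolP (u < ratr q < v); last exact: aeW.
  apply: filterS2 (flow_ordered u0 uq (lt_trans qv v1))
    (flow_ordered (lt_trans u0 uq) qv v1) => w H1 H2 _ s sT.
  by rewrite H1// H2.
apply: filterS => w Hw s t s0 st tT xuv.
apply: (coalescence_mass (X_traj w) u0 uv v1 s0 st _ xuv).
  exact: le_trans tT.
by move=> q uqv; apply: Hw => //; rewrite s0 (le_trans st).
Qed.

(* Once [u] and [v] have met, both masses are at least [v - u]. So a mass below
   [v - u] means that they have not met, and then the bracket of [X v - X u] at
   time [t] is at least [t / (v - u)]. *)
Lemma coalescence_tail u v t t' :
  0 < u -> u < v -> v < 1 -> 0 < t -> t < t' -> t' <= T ->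
  exists E : set Omega, [/\ measurable E,
    fine (P E) <= 3 * ((g v - g u) / Num.sqrt (t / (v - u))) &
    {ae P, forall w, (mass (traj w) u t' < (v - u)%:E)%E \/
      (mass (traj w) v t' < (v - u)%:E)%E -> E w}].
Proof.
move=> u0 uv v1 t0 tt' t'T.
have u01 : 0 < u < 1 by rewrite u0 (lt_trans uv).
have v01 : 0 < v < 1 by rewrite v1 (lt_trans u0).
have tT : t <= T := le_trans (ltW tt') t'T.
have tT' : 0 <= t <= T by rewrite (ltW t0).
have T0 := ltW T_gt0.
have [Quu [_ Buu Fuu] Iuu] := C4 u01 u01.
have [Qvv [_ Bvv Fvv] Ivv] := C4 v01 v01.
have [Quv [_ Buv Fuv] Iuv] := C4 u01 v01.
have [Qvu [_ Bvu Fvu] Ivu] := C4 v01 u01.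
have [mXu u2 cu] := C1 u01; have [mXv v2 cv] := C1 v01.
have [[au _ _] [av _ _]] := (mXu, mXv).
have fairu := martingale_fair mXu; have fairv := martingale_fair mXv.
pose D s w := X v s w - X u s w.
(* Both versions of the cross bracket given by (C4) are used, so that each
   difference is visibly nonnegative. *)
pose Q s w := (Quu s w - Quv s w) + (Qvv s w - Qvu s w).
have fD : fair P T F D.
  apply: eq_fair (fairD mF fairv (fairZ mF (-1) fairu)) => s w.
  by rewrite /D mulN1r.
have fN : fair P T F (fun s w => D s w ^+ 2 - Q s w).
  have f1 := fairD mF (martingale_fair Fuu) (martingale_fair Fvv).
  have f2 := fairD mF (martingale_fair Fuv) (martingale_fair Fvu).
  by apply: eq_fair (fairD mF f1 (fairZ mF (-1) f2)) => s w; rewrite /D /Q; ring.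
have D2i : P.-integrable setT (fun w => (D t w ^+ 2)%:E).
  have i2 : P.-integrable setT (EFin \o (fun w => 2 * (X u t w ^+ 2 + X v t w ^+ 2))).
    apply: integrable_scale => //.
    exact: (integrableD measurableT (u2 t tT') (v2 t tT')).
  apply: le_integrable i2 => //.
    apply/measurable_EFinP; apply: measurable_funX; apply: measurable_funB;
    exact: X_meas.
  move=> w _ /=; rewrite lee_fin ger0_norm ?sqr_ge0// ger0_norm.
    by rewrite /D; have := sqr_ge0 (X v t w + X u t w); lra.
  by rewrite mulr_ge0// addr_ge0 ?sqr_ge0.
have IQ s : 0 <= s <= T -> {ae P, forall w,
    ((Quu s w)%:E = bracket_density_integral T (traj w) u u s /\
     (Quv s w)%:E = bracket_density_integral T (traj w) u v s) /\
    ((Qvu s w)%:E = bracket_density_integral T (traj w) v u s /\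
     (Qvv s w)%:E = bracket_density_integral T (traj w) v v s)}.
  move=> sT; apply: filterS2 (filterI (Iuu s sT) (Iuv s sT))
    (filterI (Ivu s sT) (Ivv s sT)) => w [I1 I2] [I3 I4].
  by split; split.
have Q0 s : 0 <= s <= T -> {ae P, forall w, 0 <= Q s w}.
  move=> sT; apply: filterS (IQ s sT) => w [[I1 I2] [I3 I4]].
  rewrite addr_ge0// subr_ge0 -lee_fin.
    by rewrite I1 I2; exact: bracket_density_integral_le_refl.
  by rewrite I3 I4; exact: bracket_density_integral_le_refl.
have Qi : P.-integrable setT (EFin \o Q t).
  apply: (eq_integrable _ (fun w => (D t w ^+ 2)%:E - (D t w ^+ 2 - Q t w)%:E)%E) => //.
    by move=> w _; rewrite -EFinB subKr.
  by apply: integrableB => //; exact: (fN.1 t).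
have K0 : 0 < t / (v - u) by rewrite divr_gt0// subr_gt0.
exists [set w | t / (v - u) <= Q t w]; split.
- have /measurable_EFinP mQ := measurable_int _ Qi.
  have := mQ measurableT `[t / (v - u), +oo[%classic (measurable_itv _).
  rewrite setTI; congr measurable.
  by apply/seteqP; split => w /=; rewrite in_itv/= andbT.
- apply: (@bracket_tail _ _ _ P T F sF nF mF D Q (g v - g u)) => //.
  + by rewrite subr_ge0 g_ndecr ?in_itv//= ltW.
  + exact: adaptedB.
  + move=> w; have := cu w; have := cv w; rewrite /D.
    by move=> c1 c2 s; apply: continuousB; [exact: c1|exact: c2].
  + move=> s sT; apply: filterS (C3 u0 uv v1 sT) => w.
    by rewrite /D subr_ge0.
  + by apply: filterS2 (C2 u01) (C2 v01) => w Hu Hv; rewrite /D Hu Hv.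
  + apply: filterS2 (filterI Buu Buv) (filterI Bvu Bvv).
    move=> w [[q1 _ _] [q2 _ _]] [[q3 _ _] [q4 _ _]].
    by rewrite /Q q1 q2 q3 q4 !subrr addr0.
- apply: filterS2 (IQ t tT') (flow_coalescence u0 uv v1).
  move=> w [[I1 I2] [I3 I4]] coal small /=.
  have ne s : 0 <= s <= t' -> X u s w <> X v s w.
    move=> /andP[s0 st'] /(coal s t' s0 st' t'T)[m1 m2].
    by case: small; rewrite ltNge ?m1 ?m2.
  have Iuv0 := bracket_density_integral_eq0 (x := traj w) tt' t'T ne.
  have Ivu0 := bracket_density_integral_eq0 (x := traj w) tt' t'T
    (fun r h => not_eq_sym (ne r h)).
  move: I2 I3; rewrite Iuv0 Ivu0 /Q => -[->] -[->]; rewrite !subr0.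
  have vu0 : 0 < v - u by rewrite subr_gt0.
  have Quu0 : 0 <= Quu t w.
    by rewrite -lee_fin I1; exact: bracket_density_integral_ge0.
  have Qvv0 : 0 <= Qvv t w.
    by rewrite -lee_fin I4; exact: bracket_density_integral_ge0.
  (* With the cross brackets gone, [Q] is [Quu + Qvv] with both terms nonnegative, so the label
     whose mass is small suffices. Covering either label serves both one-sided growth conditions on
     [g]. *)
  case: small => small.
    have : ((t / (v - u))%:E <= (Quu t w)%:E)%E.
      rewrite I1; apply: bracket_density_integral_ge => //; first exact: ltW.
      by apply: le_trans (ltW small); apply: le_mass; exact: ltW.
    by rewrite lee_fin; lra.
  have : ((t / (v - u))%:E <= (Qvv t w)%:E)%E.
    rewrite I4; apply: bracket_density_integral_ge => //; first exact: ltW.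
    by apply: le_trans (ltW small); apply: le_mass; exact: ltW.
  by rewrite lee_fin; lra.
Qed.

End flow.

(** * Asymptotics at small times *)

Section dyadic.
Context (R : realType).

Lemma geometric_sum_le (r : R) (n : nat) : 0 <= r < 1 ->
  \sum_(k < n) r ^+ k <= (1 - r)^-1.
Proof.
move=> /andP[r0 r1]; have r1' : 0 < 1 - r by rewrite subr_gt0.
rewrite -[leRHS]mul1r ler_pdivlMr//.
have -> : (\sum_(k < n) r ^+ k) * (1 - r) = 1 - r ^+ n.
  by have := subrX1 r n; lra.
by rewrite gerBl exprn_ge0.
Qed.

Lemma dyadic_bracketing (y0 y : R) : 0 < y0 -> y0 <= y ->
  exists k : nat, y0 * 2 ^+ k <= y <= y0 * 2 ^+ k.+1.
Proof.
move=> y00 y0y.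
have ex : exists k : nat, y <= y0 * 2 ^+ k.
  have yy : 0 <= y / y0 by rewrite divr_ge0// ltW// (lt_le_trans y00).
  exists (Num.truncn (y / y0)).+1; rewrite mulrC -ler_pdivrMr//.
  have /andP[_ /ltW/le_trans->//] := truncn_itv yy.
  by rewrite -natrX ler_nat ltnW// ltn_expl.
case: (ex_minnP ex) => -[|k] yk min.
  by exists 0%N; rewrite expr0 mulr1 y0y/= expr1 (le_trans yk)// expr0 mulr1; lra.
exists k; rewrite yk andbT leNgt; apply/negP => /ltW /min.
by rewrite ltnn.
Qed.

Context (d : measure_display) (Omega : measurableType d).
Variable P : probability Omega R.

(** Almost surely [Y] is at most [y0] plus the sum of [2 * y0 * 2 ^+ k] over the events [E k] that
    occur: a value between [y0 * 2 ^+ k] and its double is paid for by the term [k]. Integration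
    leaves a geometric series. *)
Lemma dyadic_expectation_bound (Y : Omega -> R) (E : nat -> set Omega)
    (y0 c r : R) : 0 < y0 -> 0 <= c -> 0 <= r < 1 ->
  P.-integrable setT (EFin \o Y) -> {ae P, forall w, 0 <= Y w} ->
  (forall k, measurable (E k)) ->
  (forall k, {ae P, forall w, y0 * 2 ^+ k <= Y w -> E k w}) ->
  (forall k, 2 ^+ k * fine (P (E k)) <= c * r ^+ k) ->
  \int[P]_w Y w <= y0 * (1 + 2 * c / (1 - r)).
Proof.
move=> y00 c0 r01 Yi Y0 mE YE PE.
have r1' : 0 < 1 - r by rewrite subr_gt0; case/andP: r01.
pose f k w : \bar R := (2 * y0 * 2 ^+ k * \1_(E k) w)%:E.
have f0 k w : (0 <= f k w)%E.
  by rewrite lee_fin !mulr_ge0 ?exprn_ge0// ?ltW// indicE; case: (_ \in _).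
have mf k : measurable_fun setT (f k).
  apply/measurable_EFinP; apply: measurable_funM => //.
have intf k : (\int[P]_w f k w)%E = (2 * y0 * (2 ^+ k * fine (P (E k))))%:E.
  rewrite /f; under eq_integral do rewrite EFinM.
  rewrite ge0_integralZl//=; last 2 first.
  - by apply/measurable_EFinP; exact: measurable_indic.
  - by rewrite lee_fin !mulr_ge0 ?exprn_ge0// ltW.
  rewrite integral_indic// setIT -[X in (_ * X)%E]fineK ?fin_num_measure//.
  by rewrite -EFinM mulrA.
have main : (\int[P]_w (Y w)%:E <= y0%:E + \int[P]_w (\sum_(k <oo) f k w))%E.
  have -> : (y0%:E = \int[P]_w (cst y0%:E) w)%E.
    by rewrite integral_cst// [X in (_ * X)%E](probability_setT P) mule1.
  have -> : (\int[P]_w (Y w)%:E = \int[P]_w `|(Y w)%:E|)%E.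
    apply: ae_eq_integral => //.
    + exact: (measurable_int P Yi).
    + exact: (measurable_int P (integrable_abse Yi)).
    + by apply: filterS Y0 => w Yw _; rewrite gee0_abs.
  rewrite -ge0_integralD//; last 3 first.
  - by move=> w _; rewrite lee_fin ltW.
  - by move=> w _; exact: nneseries_ge0.
  - exact: ge0_emeasurable_sum.
  apply: ae_ge0_le_integral => //.
  - exact: (measurable_int P (integrable_abse Yi)).
  - by move=> w _; rewrite adde_ge0 ?nneseries_ge0// lee_fin ltW.
  - apply: emeasurable_funD => //; exact: ge0_emeasurable_sum.
  apply: filterS2 Y0 (ae_foralln YE) => w Yw YEw _ /=.
  rewrite ger0_norm//; have [Yy|yY] := ltP (Y w) y0.
    apply: (@le_trans _ _ y0%:E); first by rewrite lee_fin ltW.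
    by rewrite leeDl// nneseries_ge0.
  have [k /andP[k1 k2]] := dyadic_bracketing y00 yY.
  apply: (@le_trans _ _ (f k w)).
    rewrite /f indicE mem_set; last exact: YEw.
    by rewrite mulr1 lee_fin (le_trans k2)// exprS; lra.
  apply: (@le_trans _ _ (\sum_(k <oo) f k w)%E); last first.
    by rewrite leeDr// lee_fin ltW.
  apply: (@le_trans _ _ (\sum_(0 <= i < k.+1) f i w)%E).
    by rewrite big_nat_recr//= leeDr// sume_ge0.
  exact: nneseries_lim_ge.
have serle : (\sum_(k <oo) (\int[P]_w f k w) <= (2 * y0 * (c / (1 - r)))%:E)%E.
  apply: lime_le; first by apply: is_cvg_nneseries => k _ _; exact: integral_ge0.
  near=> n; under eq_bigr do rewrite intf.
  rewrite sumEFin lee_fin -mulr_sumr ler_pM2l ?mulr_gt0// big_mkord.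
  apply: (@le_trans _ _ (\sum_(i < n) c * r ^+ i)); first exact: ler_sum.
  by rewrite -mulr_sumr ler_wpM2l// geometric_sum_le.
rewrite -lee_fin.
have -> : ((\int[P]_w Y w)%:E = \int[P]_w (Y w)%:E)%E.
  by rewrite /Rintegral fineK//; exact: integrable_fin_num.
apply: (le_trans main); rewrite integral_nneseries//.
apply: (@le_trans _ _ (y0%:E + (2 * y0 * (c / (1 - r)))%:E)%E); first exact: leeD2l.
by rewrite -EFinD lee_fin; lra.
Unshelve. all: end_near. Qed.

End dyadic.

Lemma powR_gt1 (R : realType) (a x : R) : 0 < x -> 1 < a -> 1 < a `^ x.
Proof.
move=> x0 a1; have := @gt0_ltr_powR R x x0 1 a.
by rewrite powR1 !nnegrE ler01; apply=> //; rewrite ltW// (lt_trans ltr01).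
Qed.

Section borel_cantelli.
Context (R : realType) (d : measure_display) (Omega : measurableType d).
Variable P : probability Omega R.

Lemma borel_cantelli_ae (E : nat -> set Omega) (a : nat -> R) (b : R) :
  (forall n, measurable (E n)) -> (forall n, fine (P (E n)) <= a n) ->
  (forall n, \sum_(0 <= k < n) a k <= b) ->
  {ae P, forall w, \forall n \near \oo, ~ E n w}.
Proof.
move=> mE PE ab.
exists (lim_sup_set E); split.
- by apply: bigcapT_measurable => n; apply: bigcup_measurable => k _.
- apply: lim_sup_set_cvg0 => //; apply: (@le_lt_trans _ _ b%:E); last exact: ltry.
  apply: lime_le; first exact: is_cvg_nneseries.
  near=> n; apply: (@le_trans _ _ (\sum_(0 <= k < n) a k)%:E).
    rewrite -sumEFin; apply: lee_sum => k _.
    by rewrite -[leLHS]fineK ?fin_num_measure// lee_fin PE.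
  by rewrite lee_fin.
- move=> w /= nev N _ /=; apply: contrapT => nE; apply: nev.
  exists N => // k /= Nk Ek; apply: nE.
  by exists k.
Unshelve. all: end_near. Qed.

End borel_cantelli.

Section logarithmic_scale.
Context (R : realType).

(** Cauchy condensation: the block of indices from [2 ^ j - 1] to [2 ^ j.+1 - 2] has [2 ^ j] terms,
    each at most [2 ^ (- j p)], so the blocks are dominated by a geometric series of ratio
    [2 ^ (1 - p)]. *)
Lemma p_series_bounded (p : R) : 1 < p ->
  exists b : R, forall n, \sum_(0 <= k < n) k.+1%:R `^ (- p) <= b.
Proof.
move=> p1; pose r : R := 2 `^ (1 - p).
have r01 : 0 <= r < 1.
  rewrite powR_ge0/= /r -opprB powRN invf_lt1 ?powR_gt0//.
  by apply: powR_gt1; rewrite ?subr_gt0// ltr1n.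
have condense j : \sum_(0 <= k < (2 ^ j).-1) k.+1%:R `^ (- p) <=
    \sum_(i < j) r ^+ i :> R.
  elim: j => [|j IH]; first by rewrite big_geq// big_ord0.
  have jj : ((2 ^ j).-1 <= (2 ^ j.+1).-1)%N.
    by rewrite -!subn1 leq_sub2r// leq_exp2l.
  rewrite big_ord_recr/= (big_cat_nat _ jj)//=; apply: lerD => //.
  apply: (@le_trans _ _ (\sum_((2 ^ j).-1 <= k < (2 ^ j.+1).-1) (2 ^ j)%:R `^ (- p))).
    rewrite big_nat_cond [leRHS]big_nat_cond; apply: ler_sum => k.
    rewrite andbT => /andP[jk _].
    rewrite !powRN lef_pV2 ?posrE ?powR_gt0 ?ltr0n ?expn_gt0//.
    have jk' : (2 ^ j <= k.+1)%N by rewrite -(prednK (n := 2 ^ j)) ?expn_gt0.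
    by apply: ge0_ler_powR; rewrite ?nnegrE ?ler_nat// ltW// (lt_trans ltr01).
  rewrite sumr_const_nat.
  have -> : ((2 ^ j.+1).-1 - (2 ^ j).-1 = 2 ^ j)%N.
    rewrite expnS; have := expn_gt0 2 j; case: (2 ^ j)%N => // x _.
    by rewrite mul2n -addnn addSn/= addKn.
  rewrite -[X in X <= _]mulr_natl le_eqVlt; apply/orP; left; apply/eqP.
  have -> : (2 ^ j)%:R = 2 `^ j%:R :> R by rewrite natrX powR_mulrn.
  rewrite -powRrM -powRD ?pnatr_eq0 ?implybT// -[RHS]powR_mulrn ?powR_ge0//.
  by rewrite /r -powRrM; congr (2 `^ _); ring.
exists ((1 - r)^-1) => n.
apply: (@le_trans _ _ (\sum_(0 <= k < (2 ^ n).-1) k.+1%:R `^ (- p))); last first.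
  by apply: le_trans (condense n) _; exact: geometric_sum_le.
have nn : (n <= (2 ^ n).-1)%N.
  by rewrite -ltnS prednK ?expn_gt0// ltn_expl.
rewrite (big_cat_nat _ nn)//= lerDl sumr_ge0// => k _; exact: powR_ge0.
Qed.

Lemma powR_eventually_ge (a e : R) : 0 < e ->
  exists b : R, forall x, b <= x -> a <= x `^ e.
Proof.
move=> e0; exists (`|a| `^ e^-1) => x bx.
apply: (le_trans (ler_norm a)).
rewrite -[leLHS]powRr1// -(mulVf (lt0r_neq0 e0)) powRrM.
apply: ge0_ler_powR => //; rewrite ?nnegrE ?powR_ge0//; first exact: ltW.
exact: le_trans (powR_ge0 _ _) bx.
Qed.

Lemma ln2_gt0 : 0 < ln 2 :> R.
Proof. by apply: ln_gt0; rewrite ltr1n. Qed.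

Lemma near0_dyadic (N : nat) : \forall t \near (0 : R)^'+, exists n,
  [/\ (N <= n)%N, 2^-1 ^+ n.+1 <= t <= 2^-1 ^+ n &
      n%:R * ln 2 <= ln (1 / t) <= n.+1%:R * ln 2].
Proof.
near=> t; have t0 : 0 < t by [].
have tN : t < 2^-1 ^+ N.+1.
  by near: t; apply: nbhs_right_lt; rewrite exprn_gt0.
have y1 : 1 <= 1 / t.
  rewrite ler_pdivlMr// mul1r (le_trans (ltW tN))// exprn_ile1// invf_le1//.
  by rewrite ler1n.
have [n] := dyadic_bracketing ltr01 y1; rewrite !mul1r => /andP[n1 n2].
have p0 k : 0 < 2 ^+ k :> R by rewrite exprn_gt0.
have lnX k : ln (2 ^+ k : R) = k%:R * ln 2 by rewrite lnXn// mulr_natl.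
exists n; split.
- rewrite leqNgt; apply/negP => nN.
  have : t < t.
    apply: (lt_le_trans tN); rewrite -[leRHS]invrK exprVn lef_pV2 ?posrE ?invr_gt0//.
    by rewrite (le_trans n2)// ler_eXn2l ?ltr1n// ltnW// ltnS.
  by rewrite ltxx.
- rewrite !exprVn; apply/andP; split.
    by rewrite -[leRHS]invrK lef_pV2 ?posrE ?invr_gt0.
  by rewrite -[leLHS]invrK lef_pV2 ?posrE ?invr_gt0.
- by rewrite -!lnX !ler_ln ?posrE// ?mul1r ?invr_gt0// n1.
Unshelve. all: end_near. Qed.

End logarithmic_scale.

(** * Small-time limits from an abstract tail bound on a nondecreasing mass *)

Section small_times.
Context (R : realType) (d : measure_display) (Omega : measurableType d).
Variables (P : probability Omega R) (T alpha delta c0 : R).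
Hypothesis T_gt0 : 0 < T.
Hypothesis alpha_gt : 2^-1 < alpha.
Hypothesis delta_gt0 : 0 < delta.
Hypothesis c0_ge0 : 0 <= c0.
Variable m : R -> Omega -> \bar R.
Hypothesis m_ndecr : forall s t w, s <= t -> (m s w <= m t w)%E.
Hypothesis m_tail : forall r t, 0 < r -> r <= delta -> 0 < t -> t <= T ->
  exists E : set Omega, [/\ measurable E,
    fine (P E) <= c0 * (r `^ (alpha + 2^-1) * t `^ (- 2^-1)) &
    {ae P, forall w, (m t w < r%:E)%E -> E w}].

(** At [r = t ^ beta] the factor [r ^ (alpha + 1/2) * t ^ (-1/2)] of the tail equals one. The
    complementary exponent [gamma = 1 - beta] is the order of [t / r], hence of the bracket. *)
Let beta := 1 / (2 * alpha + 1).
Let gamma := 2 * alpha / (2 * alpha + 1).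

Let den_gt0 : 0 < 2 * alpha + 1.
Proof. by have := alpha_gt; lra. Qed.

Let beta_gt0 : 0 < beta. Proof. by rewrite divr_gt0. Qed.

Let gamma_gt0 : 0 < gamma.
Proof. by rewrite divr_gt0//; have := alpha_gt; lra. Qed.

Let beta_gamma : gamma + beta = 1.
Proof. by rewrite /gamma /beta; field; exact: lt0r_neq0. Qed.

Let beta_kappa : beta * (alpha + 2^-1) = 2^-1.
Proof. by rewrite /beta; field; exact: lt0r_neq0. Qed.

Lemma small_dyadic_times : exists N : nat, forall n, (N <= n)%N ->
  2^-1 ^+ n <= T /\ (2^-1 ^+ n) `^ beta <= delta.
Proof.
pose b : R := Num.min T (delta `^ beta^-1).
have b0 : 0 < b by rewrite lt_min T_gt0 powR_gt0.
exists (Num.truncn b^-1).+1 => n Nn.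
have nb : 2^-1 ^+ n <= b.
  rewrite -[leRHS]invrK exprVn lef_pV2 ?posrE ?invr_gt0 ?exprn_gt0//.
  have /andP[_ /ltW/le_trans->//] : (Num.truncn b^-1)%:R <= b^-1 <
      (Num.truncn b^-1).+1%:R by rewrite truncn_itv// invr_ge0 ltW.
  by rewrite -natrX ler_nat (leq_trans Nn)// ltnW// ltn_expl.
move: nb; rewrite le_min => /andP[-> nd]; split=> //.
have -> : delta = (delta `^ beta^-1) `^ beta.
  by rewrite -powRrM mulVf ?lt0r_neq0// powRr1// ltW.
by apply: ge0_ler_powR; rewrite ?nnegrE ?powR_ge0 ?exprn_ge0// ltW.
Qed.

(** At the threshold [t ^ beta / n.+1] the powers of [t] cancel in the tail, leaving
    [n.+1 ^ (- (alpha + 1/2))]. This is summable exactly because [alpha > 1/2]. *)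
Lemma mass_dyadic :
  {ae P, forall w, \forall n \near \oo,
    (((2^-1 ^+ n) `^ beta / n.+1%:R)%:E <= m (2^-1 ^+ n) w)%E}.
Proof.
have [N HN] := small_dyadic_times.
pose t n : R := 2^-1 ^+ n.
have t0 n : 0 < t n by rewrite exprn_gt0.
pose r n : R := t n `^ beta / n.+1%:R.
have r0 n : 0 < r n by rewrite divr_gt0// powR_gt0.
pose a n := c0 * n.+1%:R `^ (- (alpha + 2^-1)) : R.
have HE n : exists E : set Omega, [/\ measurable E, fine (P E) <= a n &
    {ae P, forall w, (N <= n)%N -> (m (t n) w < (r n)%:E)%E -> E w}].
  have [Nn|nN] := leqP N n; last first.
    exists set0; split=> //; first by rewrite measure0/= /a mulr_ge0 ?powR_ge0.
    exact: aeW.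
  have [tT td] := HN n Nn.
  have rd : r n <= delta.
    apply: le_trans td; rewrite ler_pdivrMr// ler_peMr ?powR_ge0//.
    by rewrite ler1n.
  have [E [mE PE HE]] := m_tail (r0 n) rd (t0 n) tT.
  exists E; split=> //; last by apply: filterS HE => w Hw _.
  apply: (le_trans PE); rewrite ler_wpM2l//.
  rewrite /r powRM ?powR_ge0 ?invr_ge0// -powRrM beta_kappa (powRN (t n)).
  rewrite -[in leLHS](@powR_inv1 R n.+1%:R)// -powRrM mulN1r.
  rewrite [leLHS](_ : _ = n.+1%:R `^ (- (alpha + 2^-1)))//.
  by field; rewrite lt0r_neq0// powR_gt0.
have [E HE'] := choice HE.
have [b Hb] : exists b : R, forall n,
    \sum_(0 <= k < n) k.+1%:R `^ (- (alpha + 2^-1)) <= b.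
  by apply: p_series_bounded; have := alpha_gt; lra.
have BC : {ae P, forall w, \forall n \near \oo, ~ E n w}.
  apply: (@borel_cantelli_ae _ _ _ P E a (c0 * b)).
  - by move=> n; have [] := HE' n.
  - by move=> n; have [] := HE' n.
  - by move=> n; rewrite /a -mulr_sumr ler_wpM2l.
have mE : {ae P, forall w, forall n,
    (N <= n)%N -> (m (t n) w < (r n)%:E)%E -> E n w}.
  by apply: ae_foralln => n; have [] := HE' n.
apply: filterS2 BC mE => w nE mEw; near=> n; rewrite leNgt; apply/negP => mr.
have : ~ E n w by near: n.
by apply; apply: mEw mr; near: n; exact: nbhs_infty_ge.
Unshelve. all: end_near. Qed.

Lemma ae_mass_small_times (e : R) : 0 < e ->
  {ae P, forall w, (m t w / (t `^ beta * ln (1 / t) `^ (- 1 - e))%:E)%E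
    @[t --> 0^'+] --> +oo%E}.
Proof.
move=> e0; apply: filterS mass_dyadic => w [N _ HN].
set ln2 := ln 2 : R; have ln20 : 0 < ln2 := ln2_gt0 R.
(* The dyadic bound is used at [n.+1], where [2 ^ - n.+1 >= t / 2] and
   [n + 2 <= 3 * n <= 3 * L / ln2]. This gives [K * t ^ beta / L] as a lower bound, and the spare
   factor [L ^ e] beats any [A / K]. *)
pose K : R := 2^-1 `^ beta * (ln2 / 3).
have K0 : 0 < K by rewrite mulr_gt0 ?powR_gt0// ?divr_gt0// invr_gt0.
apply/cvgeyPge => A.
have [b Hb] := powR_eventually_ge (A / K) e0.
pose N' := maxn N.+1 (Num.truncn (b / ln2)).+1.
have := near0_dyadic R N'; apply: filter_app; near=> t => -[n [Nn]].
have t0 : 0 < t by [].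
move=> /andP[t1 t2] /andP[L1 _].
have n0 : (0 < n)%N by apply: leq_trans Nn; rewrite leq_max.
have Nn' : (N <= n)%N by apply: leq_trans Nn; rewrite leq_max leqnSn.
set L := ln (1 / t).
have nR0 : 0 < n%:R :> R by rewrite ltr0n.
have L0 : 0 < L by apply: lt_le_trans L1; rewrite mulr_gt0.
have bL : b <= L.
  apply: le_trans L1; rewrite -ler_pdivrMr//.
  have [bb|bb] := leP (b / ln2) 0; first by rewrite (le_trans bb).
  have /andP[_ /ltW/le_trans->//] : (Num.truncn (b / ln2))%:R <= b / ln2 <
      (Num.truncn (b / ln2)).+1%:R by rewrite truncn_itv// ltW.
  by rewrite ler_nat; apply: leq_trans Nn; rewrite leq_max leqnn orbT.
rewrite inver gt_eqF ?mulr_gt0 ?powR_gt0//.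
rewrite lee_pdivlMr ?mulr_gt0 ?powR_gt0//.
apply: le_trans (m_ndecr _ t1); apply: le_trans (HN n.+1 (leqW Nn')).
rewrite -EFinM lee_fin.
apply: (@le_trans _ _ (K * (t `^ beta * L^-1))).
  rewrite powRB ?(lt0r_neq0 L0) ?implybT// powR_inv1 ?(ltW L0)//.
  rewrite [leLHS](_ : _ = A / L `^ e * (t `^ beta / L)); last first.
    by field; rewrite !lt0r_neq0// powR_gt0.
  rewrite ler_pM2r ?divr_gt0 ?powR_gt0// ler_pdivrMr ?powR_gt0//.
  by rewrite mulrC -ler_pdivrMr//; exact: Hb.
rewrite [leLHS](_ : _ = 2^-1 `^ beta * t `^ beta * (ln2 / (3 * L))); last first.
  by rewrite /K; field; rewrite lt0r_neq0.
rewrite -powRM ?(ltW t0) ?invr_ge0//; apply: ler_pM; rewrite ?powR_ge0//.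
- by rewrite divr_ge0 ?mulr_ge0// ltW.
- apply: ge0_ler_powR; rewrite ?nnegrE ?exprn_ge0//; first exact: ltW.
    by rewrite mulr_ge0 ?invr_ge0// ltW.
  by rewrite exprS ler_pM2l// invr_gt0.
rewrite ler_pdivrMr ?mulr_gt0// mulrC ler_pdivlMr//.
apply: (@le_trans _ _ (3 * (n%:R * ln2))); last by rewrite ler_pM2l.
rewrite mulrA (mulrC ln2) ler_pM2r// -!natr1.
have n1 : 1 <= n%:R :> R by rewrite ler1n.
lra.
Unshelve. all: end_near. Qed.

Section mean.
Variable Q : R -> Omega -> R.
Hypothesis Q_integrable : forall t, 0 <= t <= T -> P.-integrable setT (EFin \o Q t).
Hypothesis Q_ndecr : forall s t, 0 <= s -> s <= t -> t <= T ->
  {ae P, forall w, Q s w <= Q t w}.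
Hypothesis Q0 : {ae P, forall w, Q 0 w = 0}.
Hypothesis Q_cont : {ae P, forall w, {within `[0, T], continuous (Q^~ w)}}.
Hypothesis Q_incr : forall s t r, 0 <= s -> s <= t -> t <= T -> 0 < r ->
  {ae P, forall w, (r%:E <= m s w)%E -> Q t w <= Q s w + (t - s) / r}.

(* The dyadic series below converges because [1 < alpha + 2^-1]. *)
Lemma bracket_increment_mean : exists2 c : R, 0 <= c &
  forall t, 0 < t -> t <= T -> t `^ beta <= delta ->
  \int[P]_w Q t w - \int[P]_w Q (t / 2) w <= c * t `^ gamma.
Proof.
pose r := 2 * 2 `^ (- (alpha + 2^-1)) : R.
have r01 : 0 <= r < 1.
  rewrite mulr_ge0 ?powR_ge0//= /r powRN ltr_pdivrMr ?powR_gt0// mul1r.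
  have -> : alpha + 2^-1 = 1 + (alpha - 2^-1) by lra.
  rewrite powRD ?pnatr_eq0 ?implybT// powRr1// ltr_pMr//.
  by apply: powR_gt1; [rewrite subr_gt0|rewrite ltr1n].
(* The factor [2 ^ (1/2)] comes from the tail taken at time [t / 2]. In [r], the weight [2 ^ k] of
   the dyadic layer meets the gain [2 ^ (- k (alpha + 1/2))] from the threshold
   [t ^ beta / 2 ^ k]. *)
exists (1 + 2 * (c0 * 2 `^ 2^-1) / (1 - r)).
  have : 0 < 1 - r by rewrite subr_gt0; case/andP: r01.
  by move=> h; rewrite addr_ge0// divr_ge0 ?(ltW h)// !mulr_ge0// powR_ge0.
move=> t t0 tT tdelta.
have t20 : 0 < t / 2 by rewrite divr_gt0.
have t2t : t / 2 <= t by lra.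
have t2T : t / 2 <= T := le_trans t2t tT.
have tTT : 0 <= t <= T by rewrite (ltW t0).
have t2TT : 0 <= t / 2 <= T by rewrite (ltW t20).
rewrite -RintegralB//; [|exact: Q_integrable..].
rewrite [leRHS]mulrC.
have k0 k : 0 < 2 ^+ k :> R by rewrite exprn_gt0.
have rk0 k : 0 < t `^ beta / 2 ^+ k by rewrite divr_gt0// powR_gt0.
have rkd k : t `^ beta / 2 ^+ k <= delta.
  apply: le_trans tdelta; rewrite ler_pdivrMr// ler_peMr ?powR_ge0//.
  by rewrite exprn_ege1// ler1n.
have [E HE] := choice (fun k => m_tail (rk0 k) (rkd k) t20 t2T).
apply: (@dyadic_expectation_bound _ _ _ P _ E) => //.
- exact: powR_gt0.
- by rewrite mulr_ge0// powR_ge0.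
- exact: (integrableB measurableT (Q_integrable tTT) (Q_integrable t2TT)).
- by apply: filterS (Q_ndecr (ltW t20) t2t tT) => w; rewrite subr_ge0.
- by move=> k; have [] := HE k.
(* If the mass at [t / 2] were at least [t ^ beta / 2 ^ k], the increment would be at most
   [(t / 2) * 2 ^ k / t ^ beta], which is half of [t ^ gamma * 2 ^ k]. *)
- move=> k; have [_ _ mE] := HE k.
  apply: filterS2 mE (Q_incr (ltW t20) t2t tT (rk0 k)) => w mE QE yQ.
  apply: mE; rewrite ltNge; apply/negP => /QE.
  apply/negP; rewrite -ltNge -ltrBrDl; apply: lt_le_trans yQ.
  rewrite invf_div (_ : t - t / 2 = t / 2); last by lra.
  have tE : t = t `^ gamma * t `^ beta.
    by rewrite -powRD ?beta_gamma ?powRr1 ?(ltW t0)// (gt_eqF t0) implybT.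
  rewrite [ltLHS](_ : _ = t `^ gamma * (2 ^+ k / 2)); last first.
    by rewrite {1}tE; field; rewrite lt0r_neq0// powR_gt0.
  rewrite ltr_pM2l ?powR_gt0//.
  by rewrite ltr_pdivrMr// ltr_pMr// ltr1n.
- move=> k; have [_ PE _] := HE k.
  apply: (@le_trans _ _ (2 ^+ k * (c0 * ((t `^ beta / 2 ^+ k) `^ (alpha + 2^-1) *
    (t / 2) `^ (- 2^-1))))); first by rewrite ler_pM2l.
  rewrite le_eqVlt; apply/orP; left; apply/eqP.
  have inv2 x : 2^-1 `^ x = 2 `^ (- x) :> R.
    by rewrite -[in LHS](@powR_inv1 R 2)// -powRrM mulN1r.
  have -> : (t `^ beta / 2 ^+ k) `^ (alpha + 2^-1) =
      t `^ 2^-1 * (2 `^ (- (alpha + 2^-1))) ^+ k.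
    rewrite powRM ?powR_ge0 ?invr_ge0 ?exprn_ge0// -powRrM beta_kappa.
    rewrite -exprVn -[in LHS]powR_mulrn ?invr_ge0// -powRrM (mulrC k%:R) powRrM.
    by rewrite powR_mulrn ?powR_ge0// inv2.
  have -> : (t / 2) `^ (- 2^-1) = 2 `^ 2^-1 / t `^ 2^-1.
    by rewrite powRM ?(ltW t0) ?invr_ge0// inv2 opprK powRN mulrC.
  by rewrite /r exprMn; field; rewrite lt0r_neq0// powR_gt0.
Qed.

(** The increments over [[t / 2 ^ n.+1, t / 2 ^ n]] sum to a geometric series of ratio
    [2 ^ (- gamma)]. The remaining mean at [t / 2 ^ n] tends to zero by dominated convergence, with
    [Q T] as dominating function. *)
Lemma bracket_mean : exists2 c : R, 0 <= c &
  forall t, 0 < t -> t <= T -> t `^ beta <= delta ->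
  \int[P]_w Q t w <= c * t `^ gamma.
Proof.
have [c cge0 Hc] := bracket_increment_mean.
pose r := 2^-1 `^ gamma : R.
have r01 : 0 <= r < 1.
  rewrite powR_ge0/= /r.
  rewrite -[in ltLHS](@powR_inv1 R 2)// -powRrM mulN1r powRN invf_lt1 ?powR_gt0//.
  by apply: powR_gt1 => //; rewrite ltr1n.
have r1 : 0 < 1 - r by rewrite subr_gt0; case/andP: r01.
exists (c / (1 - r)); first by rewrite divr_ge0// ltW.
move=> t t0 tT tdelta.
pose s n : R := t * 2^-1 ^+ n.
have s0 n : 0 < s n by rewrite mulr_gt0// exprn_gt0.
have st n : s n <= t by rewrite ler_piMr ?(ltW t0)// exprn_ile1// invf_le1// ler1n.
have sT n : s n <= T := le_trans (st n) tT.
have sT' n : 0 <= s n <= T by rewrite (ltW (s0 n)) sT.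
have sd n : (s n) `^ beta <= delta.
  apply: le_trans tdelta; apply: ge0_ler_powR => //; rewrite ?nnegrE; exact: ltW.
have tele k : \int[P]_w Q t w <=
    \int[P]_w Q (s k) w + c * t `^ gamma * \sum_(i < k) r ^+ i.
  elim: k => [|n IH].
    by rewrite big_ord0 mulr0 addr0 /s expr0 mulr1.
  apply: (le_trans IH); rewrite big_ord_recr/= mulrDr addrA.
  have := Hc _ (s0 n) (sT n) (sd n).
  have -> : s n / 2 = s n.+1 by rewrite /s exprSr mulrA.
  have -> : s n `^ gamma = t `^ gamma * r ^+ n.
    rewrite /s powRM ?(ltW t0) ?exprn_ge0// -[in LHS]powR_mulrn ?invr_ge0// -powRrM.
    by rewrite (mulrC n%:R) (powRrM 2^-1) powR_mulrn// powR_ge0.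
  by lra.
have lim : \int[P]_w Q (s n) w @[n --> \oo] --> 0.
  have mQ n : measurable_fun setT (EFin \o Q (s n)).
    exact: (measurable_int P (Q_integrable (sT' n))).
  have TT : 0 <= T <= T by rewrite lexx ltW.
  have cvQ : {ae P, forall w, setT w -> (Q (s n) w)%:E @[n --> \oo] --> 0%E}.
    apply: filterS2 Q0 Q_cont => w Qw Qc _; apply: cvg_EFin.
      exact: nearW.
    apply/cvgrPdist_lt => e e0.
    have [k k0 Hk] := within_continuous_unif Qc e0.
    near=> n; rewrite -Qw; apply: Hk => //; first by rewrite lexx ltW.
    rewrite sub0r normrN gtr0_norm// /s exprVn ltr_pdivrMr ?exprn_gt0//.
    rewrite mulrC -ltr_pdivrMr//; apply: (@lt_trans _ _ n%:R).
      by near: n; exact: nbhs_infty_gtr.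
    by rewrite -natrX ltr_nat ltn_expl.
  have Qle : {ae P, forall w, forall n, setT w -> (`|(Q (s n) w)%:E| <= (Q T w)%:E)%E}.
    have H1 := ae_foralln (fun n => Q_ndecr (lexx 0) (ltW (s0 n)) (sT n)).
    have H2 := ae_foralln (fun n => Q_ndecr (ltW (s0 n)) (sT n) (lexx T)).
    apply: filterS2 Q0 (filterI H1 H2) => w Qw [H1w H2w] n _.
    by have := H1w n; rewrite Qw => Qs0; rewrite lee_fin ger0_norm.
  have [_ _] := dominated_convergence measurableT mQ
    (@measurable_cst _ _ _ _ setT (0 : \bar R)%E) cvQ (Q_integrable TT) Qle.
  by rewrite integral0 => /fine_cvg.
have : \int[P]_w Q (s n) w + c * t `^ gamma * (1 - r)^-1 @[n --> \oo] -->
    0 + c * t `^ gamma * (1 - r)^-1.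
  by apply: cvgD => //; exact: cvg_cst.
rewrite add0r => lim2.
rewrite mulrAC; apply: (cvgr_to_ge lim2); near=> n.
apply: (le_trans (tele n)); rewrite lerD2l ler_wpM2l//.
  by rewrite mulr_ge0// powR_ge0.
exact: geometric_sum_le.
Unshelve. all: end_near. Qed.

Variable M : R -> Omega -> R.
Hypothesis M_max : forall l t, 0 < l -> 0 < t -> t <= T ->
  exists E : set Omega, [/\ measurable E,
    (forall w s, 0 <= s <= t -> l < `|M s w| -> E w) &
    fine (P E) <= (\int[P]_w Q t w) / l ^+ 2].

(** The square of the level is [t ^ gamma * n.+1 ^ (1 + 2 * e)]. Its first factor cancels the mean
    of the bracket, and the second makes Doob's bounds summable. *)
Lemma running_max_dyadic (e : R) : 0 < e ->
  {ae P, forall w, \forall n \near \oo, forall s, 0 <= s <= 2^-1 ^+ n ->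
    `|M s w| <= (2^-1 ^+ n) `^ (gamma / 2) * n.+1%:R `^ (2^-1 + e)}.
Proof.
move=> e0; have [c cge0 Qmean] := bracket_mean.
have [N HN] := small_dyadic_times.
pose t n : R := 2^-1 ^+ n.
have t0 n : 0 < t n by rewrite exprn_gt0.
pose l n := t n `^ (gamma / 2) * n.+1%:R `^ (2^-1 + e) : R.
have l0 n : 0 < l n by rewrite mulr_gt0// powR_gt0.
pose a n := c * n.+1%:R `^ (- (1 + 2 * e)) : R.
have a0 n : 0 <= a n by rewrite mulr_ge0// powR_ge0.
have HE n : exists E : set Omega, [/\ measurable E, fine (P E) <= a n &
    (N <= n)%N -> forall w s, 0 <= s <= t n -> l n < `|M s w| -> E w].
  have [Nn|nN] := leqP N n; last first.
    by exists set0; split=> //; rewrite measure0.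
  have [tT td] := HN n Nn.
  have [E [mE ME PE]] := M_max (l0 n) (t0 n) tT.
  exists E; split=> //; apply: (le_trans PE).
  rewrite ler_pdivrMr ?exprn_gt0//; apply: (le_trans (Qmean _ (t0 n) tT td)).
  rewrite /a /l exprMn -!powR_mulrn ?powR_ge0// -!powRrM.
  rewrite (_ : gamma / 2 * 2 = gamma); last by lra.
  rewrite (_ : (2^-1 + e) * 2 = 1 + 2 * e); last by lra.
  rewrite powRN [leRHS](_ : _ = c * t n `^ gamma)//.
  by field; rewrite lt0r_neq0// powR_gt0.
have [E HE'] := choice HE.
have [b Hb] : exists b : R, forall n, \sum_(0 <= k < n) k.+1%:R `^ (- (1 + 2 * e)) <= b.
  by apply: p_series_bounded; lra.
apply: (filterS _ (@borel_cantelli_ae _ _ _ P E a (c * b) _ _ _)).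
- move=> w nE; near=> n => s st; rewrite leNgt; apply/negP => lM.
  have : ~ E n w by near: n.
  have [_ _ HEn] := HE' n; apply; apply: HEn lM => //.
  by near: n; exact: nbhs_infty_ge.
- by move=> n; have [] := HE' n.
- by move=> n; have [] := HE' n.
- by move=> n; rewrite /a -mulr_sumr ler_wpM2l.
Unshelve. all: end_near. Qed.

Lemma ae_cvg_small_times (e : R) : 0 < e ->
  {ae P, forall w, `|M t w| / (t `^ (gamma / 2) * ln (1 / t) `^ (2^-1 + e))
    @[t --> 0^'+] --> 0}.
Proof.
move=> e0; have e20 : 0 < e / 2 by rewrite divr_gt0.
apply: filterS (running_max_dyadic e20) => w [N _ HN].
set ln2 := ln 2 : R; have ln20 : 0 < ln2 := ln2_gt0 R.
(* From [2 ^ - n <= 2 * t] and [n + 1 <= 2 * n <= 2 * L / ln2]. Only half of [e] was spent on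
   summability; the factor [L ^ (e / 2)] left over absorbs [K / h]. *)
pose K : R := 2 `^ (gamma / 2) * (2 / ln2) `^ (2^-1 + e / 2).
have K0 : 0 < K by rewrite mulr_gt0 ?powR_gt0// divr_gt0.
apply/cvgrPdist_le => h h0.
have [b Hb] := powR_eventually_ge (K / h) e20.
pose N' := maxn N.+1 (Num.truncn (b / ln2)).+1.
have := near0_dyadic R N'; apply: filter_app; near=> t => -[n [Nn]].
have t0 : 0 < t by [].
move=> /andP[t1 t2] /andP[L1 _].
have n0 : (0 < n)%N by apply: leq_trans Nn; rewrite leq_max.
have Nn' : (N <= n)%N by apply: leq_trans Nn; rewrite leq_max leqnSn.
set L := ln (1 / t).
have nR0 : 0 < n%:R :> R by rewrite ltr0n.
have L0 : 0 < L by apply: lt_le_trans L1; rewrite mulr_gt0.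
have bL : b <= L.
  apply: le_trans L1; rewrite -ler_pdivrMr//.
  have [bb|bb] := leP (b / ln2) 0; first by rewrite (le_trans bb).
  have /andP[_ /ltW/le_trans->//] : (Num.truncn (b / ln2))%:R <= b / ln2 <
      (Num.truncn (b / ln2)).+1%:R by rewrite truncn_itv// ltW.
  by rewrite ler_nat; apply: leq_trans Nn; rewrite leq_max leqnn orbT.
rewrite sub0r normrN ger0_norm; last first.
  by rewrite divr_ge0// mulr_ge0// powR_ge0.
rewrite ler_pdivrMr ?mulr_gt0 ?powR_gt0//.
have tn : 0 <= t <= 2^-1 ^+ n by rewrite (ltW t0).
apply: (le_trans (HN n Nn' t tn)).
have g20 : 0 <= gamma / 2 by rewrite divr_ge0// ltW.
apply: (@le_trans _ _ (K * (t `^ (gamma / 2) * L `^ (2^-1 + e / 2)))).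
  rewrite /K mulrACA -!powRM ?(ltW t0) ?(ltW L0) ?divr_ge0 ?(ltW ln20)//.
  apply: ler_pM; rewrite ?powR_ge0//.
    apply: ge0_ler_powR => //; rewrite ?nnegrE ?exprn_ge0//.
      by rewrite mulr_ge0// ltW.
    by move: t1; rewrite exprS; lra.
  apply: ge0_ler_powR; rewrite ?nnegrE//; first by lra.
    by rewrite mulr_ge0 ?divr_ge0// ltW.
  rewrite mulrAC ler_pdivlMr// -natr1.
  have n1 : 1 <= n%:R :> R by rewrite ler1n.
  apply: (@le_trans _ _ (2 * (n%:R * ln2))); last by rewrite ler_pM2l.
  by rewrite mulrA ler_pM2r//; lra.
have -> : L `^ (2^-1 + e) = L `^ (2^-1 + e / 2) * L `^ (e / 2).
  rewrite -powRD ?(lt0r_neq0 L0) ?implybT//; congr (_ `^ _); lra.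
rewrite [leRHS](_ : _ = h * L `^ (e / 2) *
  (t `^ (gamma / 2) * L `^ (2^-1 + e / 2))); last by ring.
rewrite ler_pM2r ?mulr_gt0 ?powR_gt0//.
by rewrite mulrC -ler_pdivrMr//; exact: Hb.
Unshelve. all: end_near. Qed.

End mean.

End small_times.

(** * The flow as an instance of the abstract small-time setting *)

Theorem theorem1p4 (R : realType) (d : measure_display)
    (Omega : measurableType d) (P : probability Omega R)
    (T : R) (T_gt0 : 0 < T)
    (g : R -> R) (eps : R) (eps_gt0 : 0 < eps)
    (g_Lp : Lp01 (2 + eps) g)
    (g_ndecr : {in `]0, 1[ &, {homo g : u v / u <= v}})
    (g_cadlag : cadlag01 g)
    (X : R -> R -> Omega -> R)
    (X_meas : forall u t, 0 < u < 1 -> 0 <= t <= T ->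
       measurable_fun setT (X u t))
    (X_traj : forall w, D01C T (fun u t => X u t w))
    (C1 : forall u, 0 < u < 1 ->
       cont_sqint_martingale P T (natural_filtration X) (X u))
    (C2 : forall u, 0 < u < 1 -> {ae P, forall w, X u 0 w = g u})
    (C3 : forall u v t, 0 < u -> u < v -> v < 1 -> 0 <= t <= T ->
       {ae P, forall w, X u t w <= X v t w})
    (C4 : forall u v, 0 < u < 1 -> 0 < v < 1 ->
       exists2 Q : R -> Omega -> R,
         is_bracket P T (natural_filtration X) (X u) (X v) Q &
         forall t, 0 <= t <= T ->
           {ae P, forall w, (Q t w)%:E =
              bracket_density_integral T (fun u' s => X u' s w) u v t})
    (u0 : R) (u0_01 : 0 < u0 < 1) (alpha : R) (alpha_gt : 2^-1 < alpha)
    (delta : R) (delta_gt0 : 0 < delta)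
    (delta_l : 0 < u0 - delta) (delta_r : u0 + delta < 1)
    (C : R) (C_gt0 : 0 < C)
    (g_holder :
       (forall u, 0 <= u <= delta -> g (u0 + u) - g u0 <= C * u `^ alpha) \/
       (forall u, 0 <= u <= delta -> g u0 - g (u0 - u) <= C * u `^ alpha))
    (e : R) (e_gt0 : 0 < e) :
  {ae P, forall w,
    (mass (fun u s => X u s w) u0 t /
     (t `^ (1 / (2 * alpha + 1)) * ln (1 / t) `^ (- 1 - e))%:E)%E
      @[t --> 0^'+] --> +oo%E} /\
  {ae P, forall w,
    `|X u0 t w - g u0| /
     (t `^ (alpha / (2 * alpha + 1)) * ln (1 / t) `^ (2^-1 + e))
      @[t --> 0^'+] --> 0}.
Proof.
have T_ge0 := ltW T_gt0.
pose F := natural_filtration X.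
pose traj w : R -> R -> R := fun u s => X u s w.
have sF t : 0 <= t <= T -> sigma_algebra setT (F t).
  by move=> _; exact: natural_filtration_sigma_algebra.
have nF s t : 0 <= s -> s <= t -> t <= T -> F s `<=` F t.
  by move=> _ st _; exact: le_natural_filtration.
have mF t : 0 <= t <= T -> F t `<=` measurable.
  exact: natural_filtration_measurable.
have gap_tail := coalescence_tail T_gt0 g_ndecr X_meas X_traj C1 C2 C3 C4.
(* The non-meeting argument needs a time strictly before [t], chosen as [t / 2]. The bound
   [3 * C * r ^ alpha / sqrt (t / 2 / r)] then produces the factor [2 ^ (1/2)]. *)
pose c0 : R := 3 * C * 2 `^ 2^-1.
have c0_ge0 : 0 <= c0 by rewrite mulr_ge0 ?powR_ge0 ?mulr_ge0// ltW.
have m_tail r t : 0 < r -> r <= delta -> 0 < t -> t <= T ->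
    exists E : set Omega, [/\ measurable E,
      fine (P E) <= c0 * (r `^ (alpha + 2^-1) * t `^ (- 2^-1)) &
      {ae P, forall w, (mass (traj w) u0 t < r%:E)%E -> E w}].
  move=> r0 rdelta t0 tT.
  have bound : 3 * (C * r `^ alpha / Num.sqrt (t / 2 / r)) =
      c0 * (r `^ (alpha + 2^-1) * t `^ (- 2^-1)).
    have inv a : 0 <= a -> a^-1 `^ 2^-1 = (a `^ 2^-1)^-1 :> R.
      by move=> a0; rewrite -(powR_inv1 a0) -powRrM mulN1r powRN.
    have p0 a : 0 < a -> a `^ 2^-1 != 0 :> R by move=> a0; rewrite lt0r_neq0// powR_gt0.
    rewrite -powR12_sqrt ?divr_ge0 ?(ltW r0) ?(ltW t0)//.
    rewrite powRM ?divr_ge0 ?invr_ge0 ?(ltW r0) ?(ltW t0)//.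
    rewrite powRM ?invr_ge0 ?(ltW t0)// !inv ?(ltW r0)// powRN.
    rewrite powRD ?(lt0r_neq0 r0) ?implybT// /c0.
    by field; rewrite !p0.
  have t20 : 0 < t / 2 by rewrite divr_gt0.
  have t2t : t / 2 < t by lra.
  have [u00 u01] := andP u0_01.
  have Dsqrt : 0 < Num.sqrt (t / 2 / r) by rewrite sqrtr_gt0 divr_gt0.
  have r0d : 0 <= r <= delta by rewrite (ltW r0).
  case: g_holder => gH.
    have [||E [mE PE HE]] := gap_tail u0 (u0 + r) (t / 2) t u00 _ _ t20 t2t tT.
    - by rewrite ltrDl.
    - by apply: le_lt_trans delta_r; rewrite lerD2l.
    exists E; split=> //.
    - apply: (le_trans PE); rewrite -bound ler_pM2l// addrAC subrr add0r.
      by rewrite ler_pM2r ?invr_gt0//; exact: gH.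
    - apply: filterS HE => w HEw ms; apply: HEw; left.
      by rewrite addrAC subrr add0r.
  have [||E [mE PE HE]] := gap_tail (u0 - r) u0 (t / 2) t _ _ u01 t20 t2t tT.
  - by apply: lt_le_trans delta_l _; rewrite lerD2l lerN2.
  - by rewrite ltrBlDr ltrDl.
  exists E; split=> //.
  - apply: (le_trans PE); rewrite -bound ler_pM2l// subKr.
    by rewrite ler_pM2r ?invr_gt0//; exact: gH.
  - apply: filterS HE => w HEw ms; apply: HEw; right.
    by rewrite subKr.
have m_ndecr s t w : s <= t -> (mass (traj w) u0 s <= mass (traj w) u0 t)%E.
  by move=> st; exact: le_mass.
split; first exact: (ae_mass_small_times T_gt0 alpha_gt delta_gt0 c0_ge0
  m_ndecr m_tail e_gt0).
have [Q [_ BQ FQ] IQ] := C4 _ _ u0_01 u0_01.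
have [mX X2 cX] := C1 _ u0_01.
have fX : fair P T F (X u0) := martingale_fair mX.
pose M t w := X u0 t w - g u0.
have M2i t : 0 <= t <= T -> P.-integrable setT (fun w => (M t w ^+ 2)%:E).
  move=> tT; have := integrableD measurableT (X2 t tT)
    (integrableD measurableT (integrable_scale (- (2 * g u0)) measurableT (fX.1 t tT))
      (finite_measure_integrable_cst P (g u0 ^+ 2) measurableT)).
  apply: eq_integrable => // w _; rewrite -!EFinD; congr EFin.
  by rewrite /M /cst; ring.
(* Centring changes [X ^+ 2 - Q] by a multiple of the martingale [X u0] and a constant, so [Q]
   remains the bracket of [M]. *)
have fN : fair P T F (fun t w => M t w ^+ 2 - Q t w).
  apply: eq_fair (fairD mF (martingale_fair FQ)
    (fairD mF (fairZ mF (- (2 * g u0)) fX) (fair_cst _ _ _ (g u0 ^+ 2)))) => t w.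
  by rewrite /M /cst; ring.
have Q_integrable t : 0 <= t <= T -> P.-integrable setT (EFin \o Q t).
  move=> tT; apply: (eq_integrable _
    (fun w => (M t w ^+ 2)%:E - (M t w ^+ 2 - Q t w)%:E)%E) => //.
    by move=> w _; rewrite -EFinB subKr.
  by apply: integrableB => //; [exact: M2i|exact: (fN.1 t)].
have Q_ndecr s t : 0 <= s -> s <= t -> t <= T -> {ae P, forall w, Q s w <= Q t w}.
  move=> s0 st tT; have sT : 0 <= s <= T by rewrite s0 (le_trans st).
  have tT' : 0 <= t <= T by rewrite tT (le_trans s0).
  apply: filterS2 (IQ s sT) (IQ t tT') => w Is It.
  by rewrite -lee_fin Is It; exact: le_bracket_density_integral.
have Q_incr s t r : 0 <= s -> s <= t -> t <= T -> 0 < r ->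
    {ae P, forall w, (r%:E <= mass (traj w) u0 s)%E -> Q t w <= Q s w + (t - s) / r}.
  move=> s0 st tT r0; have sT : 0 <= s <= T by rewrite s0 (le_trans st).
  have tT' : 0 <= t <= T by rewrite tT (le_trans s0).
  apply: filterS2 (IQ s sT) (IQ t tT') => w Is It rm.
  by rewrite -lee_fin EFinD Is It; exact: bracket_density_integral_incr.
have Q0 : {ae P, forall w, Q 0 w = 0} by apply: filterS BQ => w [].
have Q_cont : {ae P, forall w, {within `[0, T], continuous (Q^~ w)}}.
  by apply: filterS BQ => w [].
have M_max l t : 0 < l -> 0 < t -> t <= T -> exists E : set Omega,
    [/\ measurable E, (forall w s, 0 <= s <= t -> l < `|M s w| -> E w) &
        fine (P E) <= (\int[P]_w Q t w) / l ^+ 2].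
  move=> l0 t0 tT; apply: (@running_max_tail _ _ _ P T F sF nF mF M Q) => //.
  - apply: adaptedB => //; first by case: mX.
    by apply/(adaptedP sF) => s sT; exact: measurable_cst.
  - by move=> w s; apply: continuousB; [exact: cX|exact: cst_continuous].
  - by move=> s /andP[s0 st]; exact: Q_ndecr.
  - by apply: filterS (C2 _ u0_01) => w; rewrite /M => ->; rewrite subrr.
have -> : alpha / (2 * alpha + 1) = 2 * alpha / (2 * alpha + 1) / 2.
  by field; have := alpha_gt; lra.
exact: (ae_cvg_small_times T_gt0 alpha_gt delta_gt0 c0_ge0 m_tail Q_integrable Q_ndecr
  Q0 Q_cont Q_incr M_max e_gt0).
Qed.
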